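(* Let $X$ be a Banach space, let $A,B\in\mathcal L(X)$, and let $L_AR_B\colon\mathcal L(X)\rightarrow\mathcal L(X)$ be given by $L_AR_B(T)=ATB$. Consider the following statements: (i) $L_AR_B$ is strictly singular; (ii) $L_AR_B$ is $c_0$-singular; (iii) $L_AR_B$ is weakly compact. Then (i) implies (ii). If, in addition, $X$ is reflexive and has an unconditional basis, then (ii) implies (iii).
   Context: $\mathcal L(X)$ denotes the Banach space of bounded linear operators on $X$ with the operator norm. A bounded operator $S\colon E\to F$ between Banach spaces is strictly singular if for every infinite-dimensional subspace $E_0\subseteq E$ the restriction $S|_{E_0}$ is not an isomorphism onto its range. It is $c_0$-singular if its restriction to any subspace of $E$ linearly isomorphic to $c_0$ is not an isomorphism onto its range. It is weakly compact if it maps the unit ball of $E$ to a relatively weakly compact subset of $F$. *)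

(* Defs.v *)
From HB Require Import structures.
From mathcomp Require Import all_boot all_order all_algebra.
From mathcomp Require Import all_classical all_reals all_analysis.
From mathcomp Require Import complex.

Set Implicit Arguments.
Unset Strict Implicit.
Unset Printing Implicit Defensive.

Import Order.TTheory GRing.Theory Num.Theory.
Import numFieldNormedType.Exports.

Local Open Scope classical_set_scope.
Local Open Scope ring_scope.

(* Norms of a [normedModType K] take their values in K, so the real and the
   complex case are treated together through a single scalar field K. *)
Variant scalars := RealScalars | ComplexScalars.

Definition scalar_field (R : realType) (s : scalars) : numFieldType :=
  match s with RealScalars => R | ComplexScalars => R[i] end.

(* In R[i], [z <= w] means that w - z is a nonnegative real, so least upper
   bounds exist only for sets of pairwise comparable elements. *)
Lemma scalar_supremums (R : realType) (s : scalars)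
    (A : set (scalar_field R s)) :
  A !=set0 -> (forall a, A a -> 0 <= a) -> ubound A !=set0 ->
  supremums A !=set0.
Proof.
case: s A => /= A [a Aa] A_ge0 [u uA].
  exists (sup A); split; first by apply: sup_upper_bound; split; [exists a|exists u].
  by move=> v vA; apply: ge_sup => //; exists a.
have ImA z : A z -> complex.Im z = 0.
  by move=> /A_ge0; rewrite lecE => /andP[/eqP].
pose B := [set complex.Re z | z in A].
have hsB : has_sup B.
  split; first by exists (complex.Re a), a.
  exists (complex.Re u) => _ [z Az <-].
  by have := uA z Az; rewrite lecE => /andP[].
exists (sup B)%:C%C; split=> [z Az|v vA].
  rewrite lecE /= (ImA z Az) eqxx /=; apply: sup_upper_bound => //.
  by exists z.
have := vA a Aa; rewrite !lecE /= (ImA a Aa) => /andP[-> _] /=.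
apply: ge_sup; first by exists (complex.Re a), a.
by move=> _ [z Az <-]; have := vA z Az; rewrite lecE => /andP[].
Qed.

Section BoundedOperators.
Context {K : numFieldType} (X Y : normedModType K).

Definition bounded_linear : {pred X -> Y} :=
  [pred f | `[< linear f /\ continuous f >]].

Record bop := Bop { bop_fun :> X -> Y ; _ : bop_fun \in bounded_linear }.

HB.instance Definition _ := [isSub of bop for bop_fun].
HB.instance Definition _ := [Choice of bop by <:].

Lemma bop_linear (T : bop) : linear T.
Proof. by case: T => f fP; have /asboolP[] := fP. Qed.

Lemma bop_continuous (T : bop) : continuous T.
Proof. by case: T => f fP; have /asboolP[] := fP. Qed.

HB.instance Definition _ (T : bop) :=
  GRing.isLinear.Build K X Y *:%R T (bop_linear T).

Fact bounded_linear_submod : submod_closed bounded_linear.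
Proof.
split=> [|a f g].
  apply/asboolP; split=> [b u v|]; first by rewrite scaler0 addr0.
  by move=> x; exact: cvg_cst.
move=> /asboolP[flin fc] /asboolP[glin gc]; apply/asboolP; split.
  move=> b u v; have -> x : (a *: f + g) x = a *: f x + g x by [].
  rewrite flin glin !scalerDr !scalerA (mulrC a b).
  by rewrite -!addrA; congr (_ + _); rewrite addrCA.
by move=> x; apply: cvgD; [apply: cvgZl_tmp; exact: fc|exact: gc].
Qed.

HB.instance Definition _ := GRing.isSubmodClosed.Build K (X -> Y) bounded_linear
  bounded_linear_submod.
HB.instance Definition _ :=
  [SubChoice_isSubLmodule of bop by <:].

Lemma bopD (S T : bop) x : (S + T) x = S x + T x. Proof. by []. Qed.
Lemma bopZ a (T : bop) x : (a *: T) x = a *: T x. Proof. by []. Qed.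

Definition opnorm (T : bop) : K :=
  supremum 0 [set `|T x| | x in [set x | `|x| <= 1]].

Lemma bop_bounded (T : bop) :
  exists2 M, 0 <= M & forall x, `|T x| <= M * `|x|.
Proof.
have /linear_boundedP := (linear_bounded_continuous T).2 (@bop_continuous T).
move=> /pinfty_ex_gt0[M M0 TM]; by exists M => //; exact: ltW.
Qed.

End BoundedOperators.

Arguments bounded_linear {K} X Y.

Section OperatorSpace.
Context {R : realType} {s : scalars}.
Local Notation K := (scalar_field R s).

Lemma supremumP (A : set K) : A !=set0 -> (forall a, A a -> 0 <= a) ->
  ubound A !=set0 -> supremums A (supremum 0 A).
Proof.
move=> A0 Age0 /(scalar_supremums A0 Age0)[x Ax]; rewrite /supremum.
by case: ifPn => [/eqP A0'|_]; [case: A0 => a; rewrite A0'|exact: (xgetPex 0 (ex_intro _ x Ax))].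
Qed.

Context (X Y : normedModType K).
Implicit Types T : bop X Y.

Let opnormP T : supremums [set `|T x| | x in [set x | `|x| <= 1]] (opnorm T).
Proof.
apply: supremumP.
- by exists `|T 0|, 0 => //=; rewrite normr0.
- by move=> _ [x _ <-].
- have [M M0 TM] := bop_bounded T.
  exists M => _ [x /= x1 <-]; rewrite (le_trans (TM x))//.
  by rewrite -[leRHS]mulr1 ler_wpM2l.
Qed.

Lemma opnorm_le T M : 0 <= M -> (forall x, `|T x| <= M * `|x|) -> opnorm T <= M.
Proof.
move=> M0 TM; apply: (opnormP T).2 => _ [x /= x1 <-].
by rewrite (le_trans (TM x))// -[leRHS]mulr1 ler_wpM2l.
Qed.

Lemma le_opnorm T x : `|T x| <= opnorm T * `|x|.
Proof.
have [->|x0] := eqVneq x 0; first by rewrite linear0 !normr0 mulr0.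
have nx : 0 < `|x| by rewrite normr_gt0.
rewrite -ler_pdivrMr// mulrC -[_^-1]ger0_norm ?invr_ge0// -normrZ -linearZ.
apply: (opnormP T).1; exists (`|x|^-1 *: x) => //=.
by rewrite normrZ ger0_norm ?invr_ge0// mulVf// gt_eqF.
Qed.

Lemma opnorm_ge0 T : 0 <= opnorm T.
Proof.
by apply: (opnormP T).1; exists 0; rewrite /= ?linear0 normr0.
Qed.

Let ler_opnormD S T : opnorm (S + T) <= opnorm S + opnorm T.
Proof.
apply: opnorm_le => [|x]; first by rewrite addr_ge0 ?opnorm_ge0.
by rewrite bopD mulrDl (le_trans (ler_normD _ _))// lerD ?le_opnorm.
Qed.

Let opnormZ_le a T : opnorm (a *: T) <= `|a| * opnorm T.
Proof.
apply: opnorm_le => [|x]; first by rewrite mulr_ge0 ?opnorm_ge0.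
by rewrite bopZ normrZ -mulrA ler_wpM2l ?le_opnorm.
Qed.

Let opnormZ a T : opnorm (a *: T) = `|a| * opnorm T.
Proof.
apply/eqP; rewrite eq_le opnormZ_le /=.
have [->|a0] := eqVneq a 0; first by rewrite normr0 mul0r opnorm_ge0.
rewrite -ler_pdivlMl ?normr_gt0// -normfV.
by rewrite -[in leLHS](scalerK a0 T) opnormZ_le.
Qed.

Let opnorm_eq0 T : opnorm T = 0 -> T = 0.
Proof.
move=> T0; apply/val_inj/funext => x /=; apply/normr0_eq0/eqP.
by rewrite eq_le normr_ge0 andbT (le_trans (le_opnorm T x))// T0 mul0r.
Qed.

HB.instance Definition _ := Lmodule_isNormed.Build K (bop X Y)
  ler_opnormD opnormZ opnorm_eq0.

Lemma bop_normE T : `|T| = opnorm T. Proof. by []. Qed.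

End OperatorSpace.

Section OperatorSpaceComplete.
Context {R : realType} {s : scalars}.
Local Notation K := (scalar_field R s).
Context (X : normedModType K) (Y : completeNormedModType K).

Let bop_cauchy_cvg (F : set_system (bop X Y)) :
  ProperFilter F -> cauchy F -> cvg F.
Proof.
move=> FF /cauchy_ballP Fc.
have Fcx x : cvg ((T : bop X Y) x @[T --> F]).
  apply/cauchy_cvgP/cauchy_ballP => e e0; near_simpl.
  have d0 : 0 < e / (`|x| + 1) by rewrite divr_gt0// ltr_wpDl.
  have := Fc _ d0; apply: filterS => -[S T] /=.
  rewrite -!ball_normE /= => ST.
  rewrite -[_ - _]/((S - T) x) (le_lt_trans (le_opnorm _ _))//.
  rewrite (@le_lt_trans _ _ (`|S - T| * (`|x| + 1)))//.
    by rewrite ler_wpM2l ?opnorm_ge0// lerDl.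
  by rewrite -ltr_pdivlMr// ltr_wpDl.
pose g x := lim ((T : bop X Y) x @[T --> F]).
have gP x : (T : bop X Y) x @[T --> F] --> g x by exact: Fcx.
have glin : linear g.
  move=> a u v; apply/cvg_lim => //.
  have -> : (fun T : bop X Y => T (a *: u + v)) = (fun T => a *: T u + T v).
    by apply/funext => T; rewrite linearP.
  by apply: cvgD; [apply: cvgZl_tmp; exact: gP|exact: gP].
have near_g (e : K) : 0 < e ->
    F [set T : bop X Y | forall x, `|T x - g x| <= e * `|x|].
  move=> e0; have [[P Q] [/= FP FQ PQ]] := Fc _ e0.
  apply: filterS FP => T PT x; apply/ler_addgt0Pr => d d0.
  have FQd : F (Q `&` [set S : bop X Y | `|g x - S x| < d]).
    apply: filterI => //.
    by have /cvgrPdist_lt/(_ _ d0) := gP x.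
  have [S [QS /ltW Sd]] := filter_ex FQd.
  have := PQ (T, S) (conj PT QS); rewrite /= -ball_normE /= => TS.
  rewrite -(subrKA (S x)) (le_trans (ler_normD _ _))// lerD//; last first.
    by rewrite distrC.
  rewrite -[_ - _]/((T - S) x) (le_trans (le_opnorm _ _))//.
  by rewrite ler_wpM2r// ltW.
have [T0 T0g] := filter_ex (near_g 1 ltr01).
have gcont : continuous g.
  pose gL : {linear X -> Y} := HB.pack g (GRing.isLinear.Build K X Y *:%R g glin).
  apply: (@bounded_linear_continuous _ _ _ gL).
  apply/bounded_funP => r; exists ((opnorm T0 + 1) * r) => x xr.
  apply: (@le_trans _ _ ((opnorm T0 + 1) * `|x|)); last first.
    by rewrite ler_wpM2l// addr_ge0 ?opnorm_ge0.
  rewrite -[gL x]/(g x) -(subrK (T0 x) (g x)) addrC mulrDl.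
  by rewrite (le_trans (ler_normD _ _))// lerD ?le_opnorm// distrC.
have gbop : g \in bounded_linear X Y by apply/asboolP.
apply/cvg_ex; exists (Bop gbop); apply/cvgrPdist_le => e e0.
have := near_g _ e0; apply: filterS => T Tg.
rewrite distrC; apply: opnorm_le; first exact: ltW.
by move=> x; exact: Tg.
Qed.

HB.instance Definition _ :=
  Uniform_isComplete.Build (bop X Y) bop_cauchy_cvg.

End OperatorSpaceComplete.

Section Multiplication.

Fact bop_comp_subproof {K : numFieldType} (X Y Z : normedModType K)
  (S : bop Y Z) (T : bop X Y) : (S \o T) \in bounded_linear _ _.
Proof.
apply/asboolP; split=> [a u v|x] /=; first by rewrite !linearP.
by apply: continuous_comp; exact: bop_continuous.
Qed.

Definition bop_comp {K : numFieldType} (X Y Z : normedModType K)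
  (S : bop Y Z) (T : bop X Y) : bop X Z := Bop (bop_comp_subproof S T).

Context {R : realType} {s : scalars} (X : normedModType (scalar_field R s)).
Variables A B : bop X X.

Fact bop_mult_subproof :
  (fun T : bop X X => bop_comp A (bop_comp T B)) \in bounded_linear _ _.
Proof.
have lin : linear (fun T : bop X X => bop_comp A (bop_comp T B)).
  by move=> a S T; apply/val_inj/funext => x /=; rewrite linearP.
apply/asboolP; split=> //.
pose L : {linear bop X X -> bop X X} := HB.pack
  (fun T : bop X X => bop_comp A (bop_comp T B)) (GRing.isLinear.Build _ _ _ *:%R _ lin).
apply: (@bounded_linear_continuous _ _ _ L).
apply/bounded_funP => r; exists (opnorm A * (r * opnorm B)) => T Tr.
have r0 : 0 <= r by exact: le_trans Tr.
apply: opnorm_le => [|x]; first by rewrite !mulr_ge0 ?opnorm_ge0.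
rewrite /= (le_trans (le_opnorm _ _))// -!mulrA ler_wpM2l ?opnorm_ge0//.
rewrite (le_trans (le_opnorm _ _))//.
by rewrite ler_pM ?opnorm_ge0 ?le_opnorm.
Qed.

(* T |-> A T B *)
Definition bop_mult : bop (bop X X) (bop X X) := Bop bop_mult_subproof.

End Multiplication.

Section C0.
Context (K : numFieldType).

Definition null_sequence : {pred nat -> K} :=
  [pred u | `[< u @ \oo --> (0 : K) >]].

Record c0 := C0 { c0_fun :> nat -> K; _ : c0_fun \in null_sequence }.

HB.instance Definition _ := [isSub of c0 for c0_fun].
HB.instance Definition _ := [Choice of c0 by <:].

Lemma c0_cvg (u : c0) : u @ \oo --> (0 : K).
Proof. by case: u => u uP; have /asboolP := uP. Qed.

Fact null_sequence_submod : submod_closed null_sequence.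
Proof.
split=> [|a u v]; first by apply/asboolP; exact: cvg_cst.
move=> /asboolP u0 /asboolP v0; apply/asboolP.
have := @cvgD _ K^o _ _ _ _ _ _ _ (@cvgZl_tmp _ K^o _ _ _ a u 0 u0) v0.
by rewrite (@scaler0 K K^o) (addr0 (0 : K^o)) => h; exact: h.
Qed.

HB.instance Definition _ := GRing.isSubmodClosed.Build K (nat -> K) null_sequence
  null_sequence_submod.
HB.instance Definition _ := [SubChoice_isSubLmodule of c0 by <:].

Definition c0_norm (u : c0) : K := supremum 0 (range (fun n => `|u n|)).

Lemma c0_bounded (u : c0) : exists M, forall n, `|u n| <= M.
Proof.
have /cvgrPdist_le/(_ 1 ltr01)[N _ uN] := @c0_cvg u.
exists (\sum_(i < N) `|u i| + 1) => n; have [nN|Nn] := ltnP n N.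
  rewrite (bigD1 (Ordinal nN))//= -addrA lerDl addr_ge0//.
  by rewrite sumr_ge0.
have /= := uN n Nn; rewrite sub0r normrN => /le_trans -> //.
by rewrite lerDr sumr_ge0.
Qed.

End C0.

Section C0Normed.
Context {R : realType} {s : scalars}.
Local Notation K := (scalar_field R s).
Implicit Types u v : c0 K.

Let c0_normP u : supremums (range (fun n => `|u n|)) (c0_norm u).
Proof.
apply: supremumP.
- by exists `|u 0|, 0.
- by move=> _ [n _ <-].
- by have [M uM] := c0_bounded u; exists M => _ [n _ <-].
Qed.

Lemma c0_norm_le u M : (forall n, `|u n| <= M) -> c0_norm u <= M.
Proof. by move=> uM; apply: (c0_normP u).2 => _ [n _ <-]. Qed.

Lemma le_c0_norm u n : `|u n| <= c0_norm u.
Proof. by apply: (c0_normP u).1; exists n. Qed.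

Let c0_norm_ge0 u : 0 <= c0_norm u.
Proof. exact: le_trans (le_c0_norm u 0). Qed.

Let ler_c0_normD u v : c0_norm (u + v) <= c0_norm u + c0_norm v.
Proof.
apply: c0_norm_le => n.
by rewrite (le_trans (ler_normD (u n) (v n)))// lerD ?le_c0_norm.
Qed.

Let c0_normZ_le a u : c0_norm (a *: u) <= `|a| * c0_norm u.
Proof.
apply: c0_norm_le => n.
by rewrite -[(a *: u) n]/(a * u n) normrM ler_wpM2l ?le_c0_norm.
Qed.

Let c0_normZ a u : c0_norm (a *: u) = `|a| * c0_norm u.
Proof.
apply/eqP; rewrite eq_le c0_normZ_le /=.
have [->|a0] := eqVneq a 0; first by rewrite normr0 mul0r c0_norm_ge0.
rewrite -ler_pdivlMl ?normr_gt0// -normfV.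
by rewrite -[in leLHS](scalerK a0 u) c0_normZ_le.
Qed.

Let c0_norm_eq0 u : c0_norm u = 0 -> u = 0.
Proof.
move=> u0; apply/val_inj/funext => n /=; apply/normr0_eq0/eqP.
by rewrite eq_le normr_ge0 andbT -u0 le_c0_norm.
Qed.

HB.instance Definition _ := Lmodule_isNormed.Build K (c0 K)
  ler_c0_normD c0_normZ c0_norm_eq0.

End C0Normed.

Section Subspaces.
Context {K : numFieldType}.

(* Subspaces are not required to be closed. *)
Definition linear_subspace (E : lmodType K) (E0 : set E) :=
  submod_closed [pred x in E0].

Definition finite_dimensional (E : lmodType K) (E0 : set E) :=
  exists n (e : 'I_n -> E),
    E0 = range (fun a : 'I_n -> K => \sum_(i < n) a i *: e i).

(* The restriction of S to E0 is a linear homeomorphism onto S(E0); the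
   inverse g is only constrained on S(E0), where it is linear because S is. *)
Definition isomorphism_on (E F : normedModType K) (S : {linear E -> F})
    (E0 : set E) :=
  {within E0, continuous S} /\
  exists g : F -> E, {in E0, cancel S g} /\ {within S @` E0, continuous g}.

End Subspaces.

Section OperatorClasses.
Context {R : realType} {s : scalars}.
Local Notation K := (scalar_field R s).

Definition isomorphic_to_c0 (E : normedModType K) (E0 : set E) :=
  exists J : {linear c0 K -> E}, isomorphism_on J setT /\ range J = E0.

Definition strictly_singular (E F : completeNormedModType K) (S : bop E F) :=
  forall E0 : set E, linear_subspace E0 -> ~ finite_dimensional E0 ->
    ~ isomorphism_on S E0.

Definition c0_singular (E F : completeNormedModType K) (S : bop E F) :=
  forall E0 : set E, linear_subspace E0 -> isomorphic_to_c0 E0 ->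
    ~ isomorphism_on S E0.

Definition dual (F : normedModType K) := bop F K^o.

(* The coarsest topology on F making every element of the dual continuous:
   F is pulled back from the product K^(dual F) by evaluation. *)
Definition weak_space (F : normedModType K) :=
  initial_topology (fun (y : F) => (fun phi => phi y) : {ptws dual F -> K}).

HB.instance Definition _ (F : normedModType K) :=
  Topological.on (weak_space F).

Definition weakly_compact (E F : completeNormedModType K) (S : bop E F) :=
  precompact (S @` [set x | `|x| <= 1] : set (weak_space F)).

(* The canonical embedding of X into its bidual is onto. *)
Definition reflexive_space (X : completeNormedModType K) :=
  forall Phi : dual (dual X), exists x : X, forall phi : dual X, Phi phi = phi x.

End OperatorClasses.

Section UnconditionalBases.
Context {K : numFieldType} {X : normedModType K}.

Definition schauder_basis (e : nat -> X) :=
  forall x : X, exists! a : nat -> K,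
    series (fun n => a n *: e n) @ \oo --> x.

Definition unconditionally_convergent (u : nat -> X) :=
  forall sigma : nat -> nat, bijective sigma -> cvgn (series (u \o sigma)).

Definition unconditional_basis (e : nat -> X) :=
  schauder_basis e /\
  forall a : nat -> K, cvgn (series (fun n => a n *: e n)) ->
    unconditionally_convergent (fun n => a n *: e n).

End UnconditionalBases.

(* Main.v *)
(* (i) => (ii): the range of an embedding of c0 is infinite-dimensional.

   (ii) => (iii): let P_n be the partial sum projections of the basis. If
   |A T B (1 - P_r)| did not tend to 0 for some T, a gliding hump would give
   disjoint block projections Q_k with |A Q_k T Q_k B| bounded below; by
   unconditionality a |-> sum_k a_k Q_k T Q_k is bounded on c0, and its range is
   a copy of c0 on which L_A R_B is an isomorphism. So L_A R_B takes values in
   the operators whose restriction to bounded sets is weak-to-norm continuous.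
   For such operators S_k, bounded and pointwise convergent to 0, the functions
   x |-> |S_k x| are weakly continuous on a weakly compact ball and tend to 0
   pointwise, hence phi (S_k) -> 0 for all phi in L(X)* (dominated convergence,
   obtained from Hahn-Banach and a lattice argument of Eberlein instead of the
   Riesz representation theorem). Applied to S_n = A T_n (1 - P_n) B this gives
   phi (A T P_n B) -> phi (A T B) uniformly for T in the unit ball. The
   approximants depend on finitely many coordinates T (e i), so T |-> A T B is
   continuous from the weak operator topology to the weak topology on bounded
   sets, and bounded sets are relatively compact for the weak operator topology
   because X is reflexive. *)
Require Import Defs.
From HB Require Import structures.
From mathcomp Require Import all_boot all_order all_algebra.
From mathcomp Require Import all_classical all_reals all_analysis.
From mathcomp Require Import complex lra ring zify.

Set Implicit Arguments.
Unset Strict Implicit.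
Unset Printing Implicit Defensive.

Import Order.TTheory GRing.Theory Num.Theory.
Import numFieldNormedType.Exports.

Local Open Scope classical_set_scope.
Local Open Scope ring_scope.

(** * Real-valued norms and ultrafilter limits *)

Section RealValuedNorm.
Context {R : realType} {s : scalars}.
Local Notation K := (scalar_field R s).

(** For complex scalars this is the real part, additive and real-linear on all of K, while [ofR]
    undoes it only on real scalars. *)
Definition toR : K -> R :=
  match s return scalar_field R s -> R with
  | RealScalars => fun x => x
  | ComplexScalars => fun z => complex.Re z
  end.

Definition ofR : R -> K :=
  match s return R -> scalar_field R s with
  | RealScalars => fun x => x
  | ComplexScalars => fun x => x%:C%C
  end.

Lemma toRD a b : toR (a + b) = toR a + toR b.
Proof. by rewrite /toR; move: a b; case: (s) => // -[? ?] [? ?]. Qed.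

Lemma toRZ a b : toR (ofR a * b) = a * toR b.
Proof.
rewrite /toR /ofR; move: b; case: (s) => // -[c d] /=.
by rewrite mul0r subr0.
Qed.

Lemma ofRK a : toR (ofR a) = a.
Proof. by rewrite /toR /ofR; case: (s). Qed.

Lemma toRK z : 0 <= z -> ofR (toR z) = z.
Proof.
rewrite /toR /ofR; move: z; case: (s) => //= -[a b].
by rewrite lecE => /andP[/eqP /= -> _].
Qed.

Lemma ofR_le a b : (ofR a <= ofR b) = (a <= b).
Proof. by rewrite /ofR; case: (s) => //=; rewrite lecE /= eqxx. Qed.

Lemma ofR_lt a b : (ofR a < ofR b) = (a < b).
Proof. by rewrite /ofR; case: (s) => //=; rewrite ltcE /= eqxx. Qed.

Lemma ofR0 : ofR 0 = 0. Proof. by rewrite /ofR; case: (s). Qed.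

Lemma ofR1 : ofR 1 = 1. Proof. by rewrite /ofR; case: (s). Qed.

Lemma ofRD a b : ofR (a + b) = ofR a + ofR b.
Proof. by rewrite /ofR; case: (s) => //=; rewrite -rmorphD. Qed.

Lemma ofRM a b : ofR (a * b) = ofR a * ofR b.
Proof. by rewrite /ofR; case: (s) => //=; rewrite -rmorphM. Qed.

Lemma toR_le_norm z : toR z <= toR `|z|.
Proof.
rewrite /toR; move: z; case: (s) => /= z; first exact: ler_norm.
have /= := normc_ge_Re z; rewrite normc_def lecR.
by case: z => a b /=; apply: le_trans; exact: ler_norm.
Qed.

Lemma toR_norm_ofR a : toR `|ofR a| = `|a|.
Proof.
rewrite /toR /ofR; case: (s) => //=.
by rewrite expr0n /= addr0 sqrtr_sqr.
Qed.

(* Transports the K-valued norm to R, where the order is total. *)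
Definition nm (V : normedModType K) (x : V) : R := toR `|x|.

Lemma nmE (V : normedModType K) (x : V) : `|x| = ofR (nm x).
Proof. by rewrite toRK. Qed.

Lemma norm_le_nm (V : normedModType K) (x : V) r : (`|x| <= ofR r) = (nm x <= r).
Proof. by rewrite nmE ofR_le. Qed.

Section Norm.
Context {V : normedModType K}.
Implicit Types x y : V.

Lemma nm_ge0 x : 0 <= nm x.
Proof. by rewrite -ofR_le ofR0 -nmE. Qed.

Lemma nm0 : nm (0 : V) = 0.
Proof. by rewrite /nm normr0 -ofR0 ofRK. Qed.

Lemma nmN x : nm (- x) = nm x.
Proof. by rewrite /nm normrN. Qed.

Lemma nmD x y : nm (x + y) <= nm x + nm y.
Proof. by rewrite -ofR_le ofRD -!nmE ler_normD. Qed.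

Lemma nmB x y : nm (x - y) <= nm x + nm y.
Proof. by rewrite (le_trans (nmD x (- y)))// nmN. Qed.

Lemma nmC x y : nm (x - y) = nm (y - x).
Proof. by rewrite -nmN opprB. Qed.

Lemma nm_eq0 x : nm x = 0 -> x = 0.
Proof. by move=> x0; apply: normr0_eq0; rewrite nmE x0 ofR0. Qed.

Lemma nm_gt0 x : x != 0 -> 0 < nm x.
Proof.
by move=> x0; rewrite lt_def nm_ge0 andbT; apply: contra_neq x0 => /nm_eq0.
Qed.

Lemma nmZ a x : nm (a *: x) = nm (a : K^o) * nm x.
Proof. by rewrite {1}/nm normrZ (@nmE K^o a) toRZ. Qed.

Lemma nmZR (r : R) x : nm (ofR r *: x) = `|r| * nm x.
Proof. by rewrite nmZ /nm toR_norm_ofR. Qed.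

Lemma nm_dist x y z : nm (x - z) <= nm (x - y) + nm (y - z).
Proof. by rewrite -[x - z](subrKA y) nmD. Qed.

Lemma nm_triangleB x y : nm x <= nm y + nm (x - y).
Proof. by rewrite -{1}[x](subrK y) addrC (le_trans (nmD _ _)). Qed.

Lemma nm_sum (I : Type) (r : seq I) (P : pred I) (F : I -> V) :
  nm (\sum_(i <- r | P i) F i) <= \sum_(i <- r | P i) nm (F i).
Proof.
elim/big_rec2 : _ => [|i a b _ ab]; first by rewrite nm0.
by rewrite (le_trans (nmD _ _))// lerD2l.
Qed.

Lemma cvg_nmP (T : Type) (F : set_system T) {FF : Filter F} (f : T -> V) x :
  f @ F --> x <-> forall e : R, 0 < e -> \forall t \near F, nm (x - f t) < e.
Proof.
split=> [/cvgrPdist_lt fx e e0|fx].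
  have e0' : 0 < ofR e by rewrite -ofR0 ofR_lt.
  by apply: filterS (fx _ e0') => t; rewrite nmE ofR_lt.
apply/cvgrPdist_lt => e e0; have eE := toRK (ltW e0).
have : 0 < toR e by rewrite -ofR_lt eE ofR0.
by move=> /fx; apply: filterS => t ?; rewrite nmE -eE ofR_lt.
Qed.

Lemma cvg_nm_le (T : Type) (F : set_system T) {FF : ProperFilter F}
    (f : T -> V) x M :
  f @ F --> x -> (\forall t \near F, nm (f t) <= M) -> nm x <= M.
Proof.
move=> /cvg_nmP fx fM; apply/ler_addgt0Pr => e e0.
have [t [xt tM]] := filter_ex (filterI (fx e e0) fM).
by rewrite (le_trans (nm_triangleB x (f t)))// lerD// ltW.
Qed.

Lemma cvg_nm_ge (T : Type) (F : set_system T) {FF : ProperFilter F}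
    (f : T -> V) x M :
  f @ F --> x -> (\forall t \near F, M <= nm (f t)) -> M <= nm x.
Proof.
move=> /cvg_nmP fx fM; apply/ler_addgt0Pr => e e0.
have [t [xt tM]] := filter_ex (filterI (fx e e0) fM).
by rewrite (le_trans tM)// (le_trans (nm_triangleB (f t) x))// lerD// nmC ltW.
Qed.

Lemma cvg_nm_unique (T : Type) (F : set_system T) {FF : ProperFilter F}
    (f : T -> V) x y : f @ F --> x -> f @ F --> y -> x = y.
Proof.
move=> fx fy; apply/eqP; rewrite -subr_eq0; apply/eqP/nm_eq0/le_anti.
rewrite nm_ge0 andbT; apply: (cvg_nm_le (cvgB fx fy)).
by apply: nearW => t; rewrite [X in nm X]subrr nm0.
Qed.

End Norm.

Lemma nm_bop (V W : normedModType K) (T : bop V W) x : nm (T x) <= nm T * nm x.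
Proof.
rewrite -ofR_le ofRM -!nmE bop_normE; exact: le_opnorm.
Qed.

Lemma nm_bop_le (V W : normedModType K) (T : bop V W) M : 0 <= M ->
  (forall x, nm (T x) <= M * nm x) -> nm T <= M.
Proof.
move=> M0 TM; rewrite -ofR_le -nmE bop_normE; apply: opnorm_le.
  by rewrite -ofR0 ofR_le.
by move=> x; rewrite !nmE -ofRM ofR_le.
Qed.

Lemma linear_nm_continuous (V W : normedModType K) (f : {linear V -> W}) M :
  0 <= M -> (forall x, nm (f x) <= M * nm x) -> continuous f.
Proof.
move=> M0 fM; apply: bounded_linear_continuous; apply/bounded_funP => r.
exists (ofR (M * toR r)) => x xr.
have r0 : 0 <= r by exact: le_trans xr.
rewrite norm_le_nm (le_trans (fM x))// ler_wpM2l//.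
by rewrite -ofR_le toRK// -nmE.
Qed.

Lemma bopP (V W : normedModType K) (f : V -> W) M : linear f -> 0 <= M ->
  (forall x, nm (f x) <= M * nm x) -> exists2 T : bop V W, f = T & nm T <= M.
Proof.
move=> flin M0 fM.
pose g : {linear V -> W} := HB.pack f (GRing.isLinear.Build _ _ _ *:%R f flin).
have fb : f \in bounded_linear V W.
  by apply/asboolP; split => //; exact: (@linear_nm_continuous _ _ g M).
by exists (Bop fb) => //; exact: nm_bop_le.
Qed.

Lemma fmap_ultra (S T : Type) (F : set_system S) (f : S -> T) :
  UltraFilter F -> UltraFilter (f @ F).
Proof.
move=> FU; split=> [|G GF FG]; first exact: fmap_proper_filter.
rewrite eqEsubset; split=> // A GA.
have [//|FA] := in_ultra_setVsetC (f @^-1` A) FU.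
have /filter_ex[? []//] : G (A `&` ~` A) by apply: filterI => //; exact: FG.
Qed.

Lemma ultra_cvg_real (T : Type) (F : set_system T) (f : T -> R) M :
  UltraFilter F -> (\forall t \near F, `|f t| <= M) ->
  exists a : R, f @ F --> a.
Proof.
move=> FU fM.
have := @segment_compact _ (- M) M; rewrite compact_ultra.
move=> /(_ _ (fmap_ultra f FU))[|a [_ fa]]; last by exists a.
by apply: filterS fM => t; rewrite /= in_itv /= ler_norml.
Qed.

(** One ultrafilter gives limits to all bounded scalar families at once, which spares diagonal
    subsequences. Real and imaginary parts are treated separately. *)
Lemma ultra_cvg_scalar (T : Type) (F : set_system T) (f : T -> K^o) M :
  UltraFilter F -> (\forall t \near F, nm (f t) <= M) ->
  exists a : K^o, f @ F --> a.
Proof.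
move=> FU fM; suff [a fa] : exists a : K^o,
    forall e : R, 0 < e -> \forall t \near F, nm (a - f t) < e.
  by exists a; apply/cvg_nmP.
move: f fM; rewrite /nm /toR; case: (s) => f fM.
  have [a /cvgrPdist_lt fa] := ultra_cvg_real FU fM.
  by exists a => e e0; exact: fa.
have normE (z : R[i]) :
    complex.Re `|z| = Num.sqrt (complex.Re z ^+ 2 + complex.Im z ^+ 2).
  by rewrite normc_def.
have [|a fa] := @ultra_cvg_real _ _ (fun t => complex.Re (f t)) M FU.
  apply: filterS fM => t; rewrite normE; apply: le_trans.
  by rewrite -sqrtr_sqr ler_wsqrtr// lerDl sqr_ge0.
have [|b fb] := @ultra_cvg_real _ _ (fun t => complex.Im (f t)) M FU.
  apply: filterS fM => t; rewrite normE; apply: le_trans.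
  by rewrite -sqrtr_sqr ler_wsqrtr// lerDr sqr_ge0.
exists (a +i* b)%C => e e0.
have e2 : 0 < e / 2 by rewrite divr_gt0.
move/cvgrPdist_lt : fa => /(_ _ e2) fa.
move/cvgrPdist_lt : fb => /(_ _ e2) fb.
apply: filterS2 fa fb => t ta tb; rewrite normE.
rewrite [ltRHS]splitr (le_lt_trans _ (ltrD ta tb))//.
(* The modulus is at most |re| + |im|; after squaring, this is the nonnegativity of the cross
   term. *)
case: (f t) => c d /=; rewrite -[leRHS]ger0_norm ?addr_ge0// -sqrtr_sqr.
rewrite ler_wsqrtr// -[leLHS](@addr0 R) -[in leLHS]real_normK ?num_real//.
rewrite -[X in _ + X + _]real_normK ?num_real//.
have := normr_ge0 (a - c); have := normr_ge0 (b - d); nra.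
Qed.

End RealValuedNorm.

(** * Embeddings of c0 *)

Section Embeddings.
Context {R : realType} {s : scalars}.
Local Notation K := (scalar_field R s).

Lemma nbhs_nm (V : normedModType K) (x : V) (e : R) : 0 < e ->
  \forall y \near x, nm (x - y) < e.
Proof. by have /cvg_nmP := @cvg_id _ (nbhs x); exact. Qed.

Lemma linear_subspaceB (F : numFieldType) (E : lmodType F) (E0 : set E) x y :
  linear_subspace E0 -> E0 x -> E0 y -> E0 (x - y).
Proof.
move=> [_ E0lin] x0 y0; rewrite addrC -scaleN1r.
by have := E0lin (-1) y x; rewrite !inE; exact.
Qed.

(** The lower bound makes S injective on E0 and its inverse Lipschitz with constant 1/d on the
    image. *)
Lemma bounded_below_isomorphism (E F : normedModType K) (S : {linear E -> F})
    (E0 : set E) (d : R) : linear_subspace E0 -> 0 < d -> continuous S ->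
  (forall x, E0 x -> d * nm x <= nm (S x)) -> isomorphism_on S E0.
Proof.
move=> E0lin d0 Sc Sd; split; first exact: continuous_subspaceT.
have Sinj x y : E0 x -> E0 y -> S x = S y -> x = y.
  move=> x0 y0 Sxy; apply/eqP; rewrite -subr_eq0; apply/eqP/nm_eq0/eqP.
  rewrite eq_le nm_ge0 andbT -(pmulr_rle0 _ d0) (le_trans (Sd _ _))//.
    exact: linear_subspaceB.
  by rewrite linearB /= Sxy subrr nm0.
(* Off the image of E0 the inverse takes the value 0; [isomorphism_on] constrains it on the image
   only. *)
have [g gP] : exists g : F -> E, forall x, E0 x -> g (S x) = x.
  suff /choice[g gP] : forall y, exists x, forall x', E0 x' -> S x' = y -> x = x'.
    by exists g => x x0; exact: gP.
  move=> y; have [[x [x0 Sxy]]|nx] := pselect (exists x, E0 x /\ S x = y).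
    by exists x => x' x0' Sxy'; apply: Sinj => //; rewrite Sxy'.
  by exists 0 => x' x0' Sxy'; case: nx; exists x'.
exists g; split; first by move=> x; rewrite inE => /gP.
apply/subspace_continuousP => _ [x x0 <-]; apply/cvg_nmP => e e0.
have ed : 0 < d * e by rewrite mulr_gt0.
apply: filterS (nbhs_nm (S x) ed) => _ /[swap] -[y y0 <-].
change (nm (S x - S y) < d * e -> nm (g (S x) - g (S y)) < e).
rewrite !gP// -linearB => xy; rewrite -(ltr_pM2l d0) (le_lt_trans _ xy)//.
by apply: Sd; exact: linear_subspaceB.
Qed.

Lemma nm_c0 (a : c0 K) n : nm (a n : K^o) <= nm a.
Proof. by rewrite -(@ofR_le R s) -!nmE; exact: le_c0_norm. Qed.

Lemma nm_c0_le (a : c0 K) M : (forall n, nm (a n : K^o) <= M) -> nm a <= M.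
Proof.
move=> aM; rewrite -(@ofR_le R s) -nmE; apply: c0_norm_le => n.
by rewrite (@nmE _ _ K^o) ofR_le.
Qed.

Lemma c0_tail (a : c0 K) (e : R) : 0 < e ->
  exists N, forall n, (N <= n)%N -> nm (a n : K^o) <= e.
Proof.
move=> e0; have /(@cvg_nmP _ _ K^o)/(_ _ e0)[N _ aN] := @c0_cvg _ a.
by exists N => n Nn; have := aN n Nn; rewrite /= sub0r nmN => /ltW.
Qed.

(** The tail of a null sequence is a small multiplier, so the uniform bound on multiplier sums makes
    the partial sums Cauchy. The same bound passes to the limit and bounds J. *)
Lemma c0_series (V : completeNormedModType K) (W : nat -> V) (C : R) : 0 <= C ->
  (forall n (a : nat -> K) M, (forall j, nm (a j : K^o) <= M) ->
    nm (\sum_(0 <= j < n) a j *: W j) <= C * M) ->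
  exists J : bop (c0 K) V, forall a : c0 K,
    series (fun j => a j *: W j) @ \oo --> J a.
Proof.
move=> C0 WC.
have cv (a : c0 K) : cvgn (series (fun j => a j *: W j)).
  apply/cauchy_cvgP/cauchy_seriesP => e e0.
  have eE := toRK (ltW e0).
  have e0' : 0 < toR e by rewrite -(@ofR_lt R s) eE ofR0.
  have [|N aN] := @c0_tail a (toR e / 2 / (C + 1)).
    by rewrite divr_gt0 ?divr_gt0// ltr_wpDl.
  exists ([set n | N <= n]%N, setT) => [|[m n] /= [Nm _]].
    by split; [exists N|exists 0].
  have [nm_le|mn] := leqP n m.
    by rewrite big_geq// normr0.
  (* Setting the coefficients below m to 0 turns the block into a sum starting at 0, to which the
     hypothesis applies. *)
  have -> : \sum_(m <= k < n) a k *: W k =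
      \sum_(0 <= k < n) (if (m <= k)%N then a k else 0) *: W k.
    rewrite [RHS](big_cat_nat (n := m))//=; last exact: ltnW.
    rewrite [X in _ = X + _]big_nat [X in _ = X + _]big1 ?add0r => [|k /andP[_ km]].
      by apply: eq_big_nat => k /andP[-> _].
    by rewrite leqNgt km scale0r.
  rewrite nmE -[ltRHS]eE ofR_lt.
  rewrite (@le_lt_trans _ _ (C * (toR e / 2 / (C + 1))))//.
    apply: WC => j; case: ifPn => mj; first by rewrite aN// (leq_trans Nm).
    rewrite (@nm0 _ _ K^o); apply: divr_ge0; last by rewrite addr_ge0.
      by rewrite divr_ge0 ?ltW.
  rewrite mulrA ltr_pdivrMr ?ltr_wpDl//; nra.
pose f (a : c0 K) := limn (series (fun j => a j *: W j)).
have fP (a : c0 K) : series (fun j => a j *: W j) @ \oo --> f a by exact: cv.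
have [||J fJ _] := @bopP R s (c0 K) V f C _ C0.
- move=> k a b; apply/cvg_lim => //.
  have -> : series (fun j => (k *: a + b) j *: W j) =
      (fun n => k *: series (fun j => a j *: W j) n + series (fun j => b j *: W j) n).
    apply/funext => n; rewrite /series /= scaler_sumr -big_split /=.
    by apply: eq_bigr => j _; rewrite scalerA -scalerDl.
  by apply: cvgD; [apply: cvgZl_tmp; exact: fP|exact: fP].
- move=> a; apply: (cvg_nm_le (fP a)); near=> n; apply: WC => j; exact: nm_c0.
by exists J => a; have := fP a; rewrite fJ.
Unshelve. all: by end_near. Qed.

(** A lower bound for S J yields one for J, after division by |S|, and one for S on the range of J,
    after division by |J|. That range would be a copy of c0 on which S is an isomorphism. *)
Lemma c0_singular_not_bounded_below (E F : completeNormedModType K)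
    (S : bop E F) (J : bop (c0 K) E) (d : R) : 0 < d -> c0_singular S ->
  ~ forall a : c0 K, d * nm a <= nm (S (J a)).
Proof.
move=> d0 Ssing SJ.
have linT : linear_subspace [set: c0 K] by split=> [|? ? ? _ _]; rewrite inE.
have S10 : 0 < nm S + 1 by rewrite ltr_wpDl ?nm_ge0.
have linJ : linear_subspace (range J).
  split=> [|k x y]; first by rewrite inE; exists 0; rewrite ?linear0.
  rewrite !inE => -[a _ <-] [b _ <-]; exists (k *: a + b) => //.
  by rewrite linearP.
apply: (Ssing _ linJ).
  exists J; split=> //; apply: (@bounded_below_isomorphism _ _ _ _ (d / (nm S + 1))) => //.
  - by rewrite divr_gt0.
  - exact: bop_continuous.
  - move=> a _; rewrite mulrAC ler_pdivrMr// (le_trans (SJ a))//.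
    rewrite (le_trans (nm_bop _ _))// mulrC.
    by rewrite ler_wpM2l ?nm_ge0// lerDl.
have J10 : 0 < nm J + 1 by rewrite ltr_wpDl ?nm_ge0.
apply: (@bounded_below_isomorphism _ _ _ _ (d / (nm J + 1))) => //.
- by rewrite divr_gt0.
- exact: bop_continuous.
- move=> _ [a _ <-]; rewrite (le_trans _ (SJ a))// mulrAC ler_pdivrMr// -mulrA.
  rewrite ler_pM2l// (le_trans (nm_bop J a))// mulrC.
  by rewrite ler_wpM2l ?nm_ge0// lerDl.
Qed.

Lemma c0_delta_subproof n : (fun i => (i == n)%:R : K) \in @null_sequence K.
Proof.
apply/asboolP; apply/(@cvg_nmP _ _ K^o) => e e0; exists n.+1 => // i /= ni.
by rewrite gtn_eqF// subr0 nm0.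
Qed.

Definition c0_delta n : c0 K := C0 (c0_delta_subproof n).

(** If n vectors spanned the range, the coefficients of the images of n+1 unit vectors would form a
    matrix of rank at most n; a nonzero row in its left kernel is a linear relation between unit
    vectors of c0. *)
Lemma range_c0_infinite_dimensional (E : lmodType K) (J : {linear c0 K -> E}) :
  injective J -> ~ finite_dimensional (range J).
Proof.
move=> Jinj [n [e rJ]].
have /choice[a aP] : forall j : nat, exists a : 'I_n -> K,
    J (c0_delta j) = \sum_(i < n) a i *: e i.
  move=> j; have : range J (J (c0_delta j)) by exists (c0_delta j).
  by rewrite rJ => -[a _ <-]; exists a.
pose M : 'M[K]_(n.+1, n) := \matrix_(j, i) a j i.
have : kermx M != 0.
  by rewrite kermx_eq0 /row_free neq_ltn (leq_ltn_trans (rank_leq_col M)).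
move=> /rowV0Pn[v /sub_kermxP vM v0]; move/negP : v0; apply.
have : J (\sum_(j < n.+1) v 0 j *: c0_delta j) = J 0.
  rewrite linear0 linear_sum /=.
  under eq_bigr do rewrite linearZ /= aP scaler_sumr.
  rewrite exchange_big big1 //= => i _.
  under eq_bigr do rewrite scalerA.
  rewrite -scaler_suml; have := congr1 (fun m : 'rV[K]_n => m 0 i) vM.
  rewrite !mxE => vMi.
  suff -> : \sum_(j < n.+1) v 0 j * a j i = 0 by rewrite scale0r.
  rewrite -[RHS]vMi.
  by apply: eq_bigr => j _; rewrite mxE.
move=> /Jinj vd; apply/eqP/rowP => j; rewrite mxE.
have <- : (\sum_(j < n.+1) v 0 j *: c0_delta j) j = v 0 j.
  have evalE (u : 'I_n.+1 -> c0 K) (r : seq 'I_n.+1) i :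
      (\sum_(k <- r) u k) i = \sum_(k <- r) u k i.
    by elim: r => [|k r IH]; rewrite ?big_nil// !big_cons -IH.
  rewrite evalE (bigD1 j)//= big1 => [|k kj].
    by rewrite addr0 -[LHS]/(v 0 j * (val j == j)%:R) eqxx mulr1.
  rewrite -[LHS]/(v 0 k * (val j == val k)%:R) val_eqE eq_sym (negPf kj).
  by rewrite mulr0.
by rewrite vd.
Qed.

Lemma strictly_singular_c0_singular (E F : completeNormedModType K) (S : bop E F) :
  strictly_singular S -> c0_singular S.
Proof.
move=> Sss E0 E0lin [J [[_ [g [Jg _]]] JE0]]; apply: Sss => //.
rewrite -JE0; apply: range_c0_infinite_dimensional => a b ab.
by rewrite -(Jg a) ?inE// ab Jg ?inE.
Qed.

End Embeddings.

(** * Unconditional bases *)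

Section SubsetSums.
Context {R : realType} {s : scalars} {V : normedModType (scalar_field R s)}.

(* If the subset sums were unbounded, there would be successive blocks of
   indices each containing a subset of large sum; listing that subset first in
   every block gives a rearrangement that is not Cauchy. *)
Lemma unconditional_bounded (u : nat -> V) : unconditionally_convergent u ->
  exists M : R, forall (F : pred nat) n, nm (\sum_(0 <= i < n | F i) u i) <= M.
Proof.
move=> uc; apply: contrapT => /forallNP nM.
have big m : exists p : nat * pred nat,
    (m < p.1)%N /\ 1 < nm (\sum_(m <= i < p.1 | p.2 i) u i).
  (* A subset sum exceeding 1 plus the total norm of the terms below m must exceed 1 on the indices
     from m on. *)
  have /existsNP[F /existsNP[n /negP]] := nM (1 + \sum_(0 <= i < m) nm (u i)).
  rewrite -ltNge => nF; exists (n, F) => /=.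
  have sub k : nm (\sum_(0 <= i < k | F i) u i) <= \sum_(0 <= i < k) nm (u i).
    rewrite (le_trans (nm_sum _ _ _))// [leRHS](bigID F)/= lerDl.
    by rewrite sumr_ge0// => i _; exact: nm_ge0.
  have [nm_le|mn] := leqP n m.
    have : \sum_(0 <= i < n) nm (u i) <= \sum_(0 <= i < m) nm (u i).
      rewrite [leRHS](big_cat_nat (n := n))//= lerDl.
      by rewrite sumr_ge0// => i _; exact: nm_ge0.
    by have := lt_le_trans nF (sub n); lra.
  split=> //; rewrite -(ltrD2r (\sum_(0 <= i < m) nm (u i))) (lt_le_trans nF)//.
  rewrite (big_cat_nat (n := m))//=; last exact: ltnW.
  by rewrite addrC (le_trans (nmD _ _))// lerD2l sub.
have {big}/choice[nF nFP] := big.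
(* [L k] enumerates an initial segment of the naturals; each step appends the next block, its chosen
   subset first and the rest after it. *)
pose blk m := [seq i <- index_iota m (nF m).1 | (nF m).2 i].
pose blkC m := [seq i <- index_iota m (nF m).1 | predC (nF m).2 i].
pose step (l : seq nat) := l ++ blk (size l) ++ blkC (size l).
pose L k := iter k step [::].
have LS k : L k.+1 = L k ++ blk (size (L k)) ++ blkC (size (L k)) by [].
have sizeL k : size (L k.+1) = (nF (size (L k))).1.
  rewrite LS !size_cat !size_filter count_predC size_iota subnKC//.
  exact: ltnW (nFP _).1.
have ltL k : (size (L k) < size (L k.+1))%N by rewrite sizeL (nFP _).1.
have leL k : (k <= size (L k))%N.
  by elim: k => // k IH; rewrite (leq_ltn_trans IH).
have permL k : perm_eq (L k) (iota 0 (size (L k))).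
  elim: k => // k IH; rewrite sizeL LS.
  have -> : iota 0 (nF (size (L k))).1 =
      iota 0 (size (L k)) ++ index_iota (size (L k)) (nF (size (L k))).1.
    by rewrite -[X in index_iota X _]add0n -iotaD subnKC// ltnW// (nFP _).1.
  by rewrite perm_cat// perm_filterC.
have nthL i k j : (i < size (L k))%N -> nth 0%N (L (k + j)%N) i = nth 0%N (L k) i.
  move=> ik; elim: j => [|j IH]; first by rewrite addn0.
  rewrite addnS LS nth_cat IH ifT//.
  rewrite (leq_trans ik)//; elim: (j) => [|j' IH']; first by rewrite addn0.
  by rewrite (leq_trans IH')// addnS ltnW.
(* [L i.+1] has more than i entries, so the default 0 is never returned; longer lists extend it and
   give the same value. *)
pose sigma i := nth 0%N (L i.+1) i.
have sigmaE i k : (i < size (L k))%N -> sigma i = nth 0%N (L k) i.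
  move=> ik; rewrite /sigma; have [le|/ltnW le] := leqP i.+1 k.
    by rewrite -(subnKC le) nthL.
  by rewrite -(subnKC le) nthL.
have uniqL k : uniq (L k) by rewrite (perm_uniq (permL k)) iota_uniq.
have inj_sigma : injective sigma.
  move=> i j; pose k := (maxn i j).+1.
  have ik : (i < size (L k))%N by rewrite (leq_trans _ (leL k))// ltnS leq_maxl.
  have jk : (j < size (L k))%N by rewrite (leq_trans _ (leL k))// ltnS leq_maxr.
  by rewrite (sigmaE _ _ ik) (sigmaE _ _ jk) => /eqP; rewrite nth_uniq// => /eqP.
have surj_sigma v : exists i, sigma i = v.
  have vL : v \in L v.+1 by rewrite (perm_mem (permL _)) mem_iota add0n leL.
  by exists (index v (L v.+1)); rewrite (sigmaE _ v.+1) ?index_mem// nth_index.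
have /choice[tau tauP] := surj_sigma.
have /uc/cvg_ex[l /cvg_nmP/(_ (2^-1) _)[|N _ Nl]] : bijective sigma.
  by exists tau => // i; apply: inj_sigma; rewrite tauP.
- by rewrite invr_gt0.
(* Between a and b the rearranged series runs through exactly the chosen subset, whose sum exceeds 1
   in norm, although both partial sums lie within 1/2 of the limit. *)
pose a := size (L N); pose b := (a + size (blk a))%N.
have := nmB (l - series (u \o sigma) a) (l - series (u \o sigma) b).
apply/negP; rewrite -ltNge (lt_trans (ltrD (Nl a _) (Nl b _)))//=.
  by rewrite /= (leq_trans (leL N))// leq_addr.
rewrite opprB [X in nm X]addrC subrKA sub_series_geq ?leq_addr// /comp.
have -> : \sum_(a <= i < b) u (sigma i) = \sum_(i <- blk a) u i.
  suff <- : [seq sigma i | i <- index_iota a b] = blk a by rewrite big_map.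
  have sab : size (index_iota a b) = size (blk a) by rewrite size_iota addKn.
  apply: (@eq_from_nth _ 0%N); rewrite size_map sab// => i ib.
  rewrite (nth_map 0%N) ?sab// nth_iota ?addKn// (sigmaE _ N.+1); last first.
    rewrite LS !size_cat -/a ltn_add2l.
    by rewrite (leq_trans ib)// leq_addr.
  rewrite LS nth_cat -/a ltnNge leq_addr /= addKn.
  by rewrite nth_cat ib.
by rewrite /blk big_filter; have := (nFP a).2; lra.
Qed.

End SubsetSums.

(** * Baire category and limits of finite sums *)

Section Completeness.
Context {R : realType} {s : scalars}.
Local Notation K := (scalar_field R s).

Lemma cvg_nm_cauchy (X : completeNormedModType K) (u : nat -> X) :
  (forall e : R, 0 < e ->
    exists N, forall n, (N <= n)%N -> nm (u n - u N) < e) ->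
  cvgn u.
Proof.
move=> uc; apply/cauchy_cvgP/cauchy_exP => e e0; have eE := toRK (ltW e0).
have /uc[N uN] : 0 < toR e by rewrite -(@ofR_lt R s) eE ofR0.
exists (u N); exists N => // n /= Nn.
by rewrite -ball_normE /= nmE -eE ofR_lt nmC uN.
Qed.

(** Were no [E M] dense in any ball, one could nest balls that avoid the sets [E k] one after
    another, and their centres would converge to a point outside all of them. *)
Lemma baire_cover (X : completeNormedModType K) (E : nat -> set X) :
  (forall x, exists M, E M x) ->
  exists M x0 (r : R), 0 < r /\ forall y, nm (y - x0) < r ->
    forall d : R, 0 < d -> exists2 z, E M z & nm (y - z) < d.
Proof.
move=> Ecover; apply: contrapT => nE.
have /choice[f fP] : forall p : nat * (X * R), exists q : X * R,
    0 < p.2.2 -> [/\ nm (q.1 - p.2.1) < p.2.2, 0 < q.2 &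
      forall z, E p.1 z -> q.2 <= nm (q.1 - z)].
  move=> [M [x r]] /=; have [r0|?] := pselect (0 < r); last by exists (0, 0).
  apply: contrapT => nq; apply: nE; exists M, x, r; split=> // y yx d d0.
  apply: contrapT => nz; apply: nq; exists (y, d) => _ /=; split=> // z Mz.
  by rewrite leNgt; apply/negP => yz; apply: nz; exists z.
(* The three bounds on the new radius keep the new ball away from [E k], halve the radii, and keep
   the new ball inside the old one. *)
pose step k (p : X * R) := let q := f (k, p) in
  (q.1, Num.min (q.2 / 2) (Num.min (p.2 / 2) ((p.2 - nm (q.1 - p.1)) / 2))).
pose st := fix st k := if k is k'.+1 then step k' (st k') else (0, 1).
have r_gt0 k : 0 < (st k).2.
  elim: k => [|k IH] //=; have [yx q0 _] := fP (k, st k) IH.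
  by rewrite !lt_min !divr_gt0// subr_gt0.
have stS k : [/\ (st k.+1).2 <= (st k).2 / 2,
    nm ((st k.+1).1 - (st k).1) + 2 * (st k.+1).2 <= (st k).2 &
    forall z, E k z -> 2 * (st k.+1).2 <= nm ((st k.+1).1 - z)].
  have [yx q0 qz] := fP (k, st k) (r_gt0 k); rewrite /=.
  set q := f _; set m := Num.min _ _.
  have m1 : m <= q.2 / 2 by rewrite ge_min lexx.
  have m2 : m <= (st k).2 / 2 by rewrite !ge_min lexx orbT.
  have m3 : m <= ((st k).2 - nm (q.1 - (st k).1)) / 2.
    by rewrite !ge_min lexx !orbT.
  split=> [//||z kz]; first lra.
  by apply: le_trans (qz z kz); lra.
have st_dist k j : nm ((st (k + j)%N).1 - (st k).1) + (st (k + j)%N).2 <= (st k).2.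
  elim: j => [|j IH]; first by rewrite addn0 subrr nm0 add0r.
  have [_ h _] := stS (k + j)%N; have h0 := r_gt0 (k + j).+1.
  have := nm_dist (st (k + j).+1).1 (st (k + j)%N).1 (st k).1.
  by rewrite addnS; lra.
have r_small k : (st k).2 <= k.+1%:R^-1.
  elim: k => [|k IH]; first by rewrite invr1.
  have [h _ _] := stS k; rewrite (le_trans h)// (le_trans (ler_wpM2r _ IH))//.
  rewrite -invfM lef_pV2 ?posrE ?mulr_gt0 ?ltr0n// -natrM ler_nat; lia.
have /cvg_ex[x xP] : cvgn (fun k => (st k).1).
  apply: cvg_nm_cauchy => e e0; have [N _ /(_ N (leqnn N)) /= Ne] :=
    near_infty_natSinv_lt (PosNum e0).
  exists N => n Nn; rewrite -(subnKC Nn) (le_lt_trans _ Ne)//.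
  rewrite (le_trans _ (r_small N))// (le_trans _ (st_dist N (n - N)%N))//.
  by rewrite lerDl ltW.
have [M Mx] := Ecover x; have [_ _ /(_ x Mx)] := stS M.
apply/negP; rewrite -ltNge (@le_lt_trans _ _ (st M.+1).2)//; last first.
  by have := r_gt0 M.+1; lra.
have xM : (fun k => (st k).1 - (st M.+1).1) @ \oo --> x - (st M.+1).1.
  by apply: cvgB => //; exact: cvg_cst.
rewrite nmC; apply: (cvg_nm_le xM); exists M.+1 => // n /= Mn.
rewrite -(subnKC Mn) (le_trans _ (st_dist M.+1 (n - M.+1)%N))//.
by rewrite lerDl ltW.
Qed.

Lemma cvg_bigsum (V : normedModType K) (T I : Type) (F : set_system T)
    {FF : Filter F} (r : seq I) (P : pred I) (f : I -> T -> V) (l : I -> V) :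
  (forall i, P i -> f i @ F --> l i) ->
  (fun t => \sum_(i <- r | P i) f i t) @ F --> \sum_(i <- r | P i) l i.
Proof.
move=> fl; elim: r => [|i r IH].
  by rewrite big_nil; under eq_fun do rewrite big_nil; exact: cvg_cst.
rewrite big_cons; under eq_fun do rewrite big_cons.
by case: ifPn => // Pi; apply: cvgD => //; exact: fl.
Qed.

Lemma cvg_nmZ (V : normedModType K) (T : Type) (F : set_system T)
    {FF : Filter F} (f : T -> K^o) (a : K^o) (x : V) :
  f @ F --> a -> (fun t => (f t : K) *: x) @ F --> (a : K) *: x.
Proof.
move=> /cvg_nmP fa; apply/cvg_nmP => e e0.
have x1 : 0 < nm x + 1 by rewrite ltr_wpDl ?nm_ge0.
apply: filterS (fa (e / (nm x + 1)) _) => [t at_|]; last by rewrite divr_gt0.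
rewrite -scalerBl nmZ; move: at_; rewrite ltr_pdivlMr// => /(le_lt_trans _); apply.
by rewrite ler_wpM2l ?nm_ge0// lerDl.
Qed.

End Completeness.

(** * Coordinates and the uniform bound on subset sums *)

Section Basis.
Context {R : realType} {s : scalars}.
Local Notation K := (scalar_field R s).
Context {X : completeNormedModType K}.
Implicit Types (e : nat -> X) (co : X -> nat -> K).

(** One equivalence carries both the expansion of x and its uniqueness, so coordinates are computed
    by exhibiting a convergent series. *)
Definition coordinates e co := forall x (a : nat -> K),
  series (fun n => a n *: e n) @ \oo --> x <-> a = co x.

Lemma schauder_coordinates e : schauder_basis e -> exists co, coordinates e co.
Proof.
move=> eb; have cP : forall x : X, exists b : nat -> K,
    forall a : nat -> K, series (fun n => a n *: e n) @ \oo --> x <-> a = b.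
  by move=> x; have [b [bx bu]] := eb x; exists b => a; split=> [/bu|->].
by have [co coP] := choice cP; exists co.
Qed.

Context {e : nat -> X} {co : X -> nat -> K} (coP : coordinates e co).

Definition psum (F : pred nat) n (x : X) : X :=
  \sum_(0 <= i < n | F i) co x i *: e i.

Lemma psum_cvg x : (fun n => psum xpredT n x) @ \oo --> x.
Proof. exact: ((coP x (co x)).2 erefl). Qed.

Lemma coordinate_linear k x y i : co (k *: x + y) i = k * co x i + co y i.
Proof.
suff <- : (fun i => k * co x i + co y i) = co (k *: x + y) by [].
apply/coP; have -> : series (fun n => (k * co x n + co y n) *: e n) =
    (fun n => k *: psum xpredT n x + psum xpredT n y).
  apply/funext => n; rewrite /series /psum /= scaler_sumr -big_split /=.
  by apply: eq_bigr => j _; rewrite scalerA -scalerDl.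
by apply: cvgD; [apply: cvgZl_tmp|]; exact: psum_cvg.
Qed.

Lemma psum_linear F n : linear (psum F n).
Proof.
move=> k x y; rewrite /psum scaler_sumr -big_split /=.
by apply: eq_bigr => j _; rewrite scalerA -scalerDl coordinate_linear.
Qed.

Lemma psumB F n x y : psum F n (x - y) = psum F n x - psum F n y.
Proof. by rewrite addrC -scaleN1r psum_linear scaleN1r addrC. Qed.

Lemma psumZ F n k x : psum F n (k *: x) = k *: psum F n x.
Proof.
have p0 : psum F n 0 = 0 by rewrite -[X in psum _ _ X](subrr 0) psumB subrr.
by rewrite -[k *: x]addr0 psum_linear p0 addr0.
Qed.

(** If [e i] were 0, the zero vector would have an expansion with i-th coefficient 1 besides the
    trivial one. *)
Lemma basis_neq0 i : e i != 0.
Proof.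
apply/eqP => ei0.
have cv (k : K) : series (fun n => (if n == i then k else 0) *: e n) @ \oo --> (0 : X).
  have -> : series (fun n => (if n == i then k else 0) *: e n) = cst 0.
    apply/funext => n; rewrite /series /= big1// => j _.
    by case: eqP => [->|]; rewrite ?ei0 ?scaler0 ?scale0r.
  exact: cvg_cst.
have /coP h1 := cv 1; have /coP h0 := cv 0.
have := congr1 (fun f => f i) (etrans h1 (esym h0)).
by rewrite eqxx => /eqP; rewrite oner_eq0.
Qed.

Lemma nm_coordinate i x : nm (co x i : K^o) * nm (e i) = nm (psum (pred1 i) i.+1 x).
Proof.
rewrite -nmZ /psum big_mkcond big_nat_recr//= eqxx big_nat big1 ?add0r// => j.
by move=> /andP[_ ji]; rewrite ltn_eqF.
Qed.

Definition bounded_psum (M : R) : set X :=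
  [set x | forall F n, nm (psum F n x) <= M].

Lemma bounded_psumB M N x y : bounded_psum M x -> bounded_psum N y ->
  bounded_psum (M + N) (x - y).
Proof.
by move=> xM yN F n; rewrite psumB (le_trans (nmB _ _))// lerD.
Qed.

(** By Baire, the vectors whose subset sums are bounded by some M are dense in a ball; differences
    move the ball to the origin, and scaling reaches every radius. *)
Lemma bounded_psum_dense : (forall x, exists M, bounded_psum M x) ->
  exists2 L : R, 0 < L & forall (t : R) y, 0 < t -> nm y <= t ->
    forall d : R, 0 < d ->
    exists2 z, bounded_psum (L * t) z & nm (y - z) < d.
Proof.
move=> bnd; have [|M [x0 [r [r0 rP]]]] := @baire_cover _ _ X (fun n => bounded_psum n%:R).
  move=> x; have [M xM] := bnd x; exists (Num.bound `|M|) => F n.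
  rewrite (le_trans (xM F n))// (le_trans (ler_norm M))//.
  by rewrite ltW// archi_boundP.
(* The difference of two approximants costs 2M, and undoing the scaling by c = r / (2t) costs 2t/r;
   the added 1 keeps the constant positive when M = 0. *)
exists (4 * M%:R / r + 1) => [|t y t0 yt d d0].
  by rewrite ltr_wpDl// divr_ge0 ?mulr_ge0 ?ler0n// ltW.
pose c := r / 2 / t.
have c0 : 0 < c by rewrite !divr_gt0.
have cd : 0 < c * d / 2 by rewrite divr_gt0// mulr_gt0.
have [p pM yp] : exists2 z, bounded_psum M%:R z & nm ((x0 + ofR c *: y) - z) < c * d / 2.
  apply: rP => //; rewrite addrAC subrr add0r nmZR gtr0_norm//.
  rewrite (@le_lt_trans _ _ (c * t))//; first by rewrite ler_wpM2l// ltW.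
  by rewrite /c divfK ?gt_eqF//; lra.
have [|q qM xq] := rP x0 _ _ cd; first by rewrite subrr nm0.
exists (ofR c^-1 *: (p - q)) => [F n|].
  rewrite psumZ nmZR gtr0_norm ?invr_gt0//.
  rewrite (@le_trans _ _ (c^-1 * (M%:R + M%:R)))//.
    by rewrite ler_wpM2l ?invr_ge0 ?(ltW c0)//; exact: bounded_psumB.
  rewrite /c mulrDl mul1r (@le_trans _ _ (4 * M%:R / r * t))//; last first.
    by rewrite lerDl ltW.
  suff -> : (r / 2 / t)^-1 * (M%:R + M%:R) = 4 * M%:R / r * t by [].
  by field; rewrite !lt0r_neq0.
have -> : y - ofR c^-1 *: (p - q) =
    ofR c^-1 *: ((x0 + ofR c *: y - p) - (x0 - q)).
  have -> : (x0 + ofR c *: y - p) - (x0 - q) = ofR c *: y - (p - q).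
    rewrite !opprB [x0 + _]addrC -!addrA; congr (_ + _).
    by rewrite addrC -addrA subrK addrC.
  by rewrite [in RHS]scalerBr scalerA -ofRM mulVf ?gt_eqF// ofR1 scale1r.
rewrite nmZR gtr0_norm ?invr_gt0// mulrC ltr_pdivrMr//.
rewrite (le_lt_trans (nmB _ _))//; have := ltrD yp xq; rewrite [d * c]mulrC.
by lra.
Qed.


(** Successive approximation, as in the open mapping theorem: x is a sum of vectors whose subset
    sums are bounded by L 2^-k. What remains is to identify the coordinates of x with the limits of
    those of the finite sums. *)
Lemma psum_bound : (forall x, exists M, bounded_psum M x) ->
  exists2 C : R, 0 <= C & forall F n x, nm (psum F n x) <= C * nm x.
Proof.
move=> /bounded_psum_dense[L L0 dense].
suff unit_ball x : nm x <= 1 -> bounded_psum (2 * L) x.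
  exists (2 * L) => [|F n x]; first by rewrite mulr_ge0 ?ltW.
  have [->|x0] := eqVneq x 0.
    rewrite nm0 mulr0 -[X in psum _ _ X](subrr 0) psumB subrr nm0//.
  have nx := nm_gt0 x0; rewrite -ler_pdivrMr// mulrC.
  rewrite -[X in X * _]gtr0_norm ?invr_gt0// -nmZR -psumZ.
  by apply: unit_ball; rewrite nmZR gtr0_norm ?invr_gt0// mulVf ?gt_eqF.
move=> x1.
pose t k : R := 2^-1 ^+ k.
have t0 k : 0 < t k by rewrite exprn_gt0// invr_gt0.
have tS k : t k = 2 * t k.+1 by rewrite /t exprS mulrA mulfV ?mul1r.
have /choice[f fP] : forall p : nat * X, exists z : X,
    nm p.2 <= t p.1 -> bounded_psum (L * t p.1) z /\ nm (p.2 - z) < t p.1.+1.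
  move=> [k y] /=; have [yt|?] := pselect (nm y <= t k); last by exists 0.
  by have [z ? ?] := dense _ _ (t0 k) yt _ (t0 k.+1); exists z.
pose y := fix y k := if k is k'.+1 then y k' - f (k', y k') else x.
have yt k : nm (y k) <= t k.
  by elim: k => // k IH; have [_ /ltW] := fP (k, y k) IH.
have yB k j : bounded_psum (2 * L * (t k - t (k + j)%N)) (y k - y (k + j)%N).
  elim: j => [|j IH].
    rewrite addn0 !subrr mulr0 => F n.
    by rewrite -[X in psum _ _ X](subrr 0) psumB subrr nm0.
  have [fB _] := fP (_, _) (yt (k + j)%N); rewrite addnS /= => F n.
  have -> : y k - (y (k + j)%N - f ((k + j)%N, y (k + j)%N)) =
      (y k - y (k + j)%N) - (0 - f ((k + j)%N, y (k + j)%N)).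
    by rewrite sub0r opprK opprB addrA [RHS]addrAC; congr (_ - _); rewrite addrC.
  have fk : nm (psum F n (0 - f ((k + j)%N, y (k + j)%N))) <= L * t (k + j)%N.
    by rewrite sub0r -scaleN1r psumZ scaleN1r nmN; exact: fB.
  rewrite psumB (le_trans (nmB _ _))// (le_trans (lerD (IH F n) fk))//.
  by rewrite (tS (k + j)%N); lra.
have xyB k : bounded_psum (2 * L) (x - y k).
  move=> F n; rewrite (le_trans (yB 0 k F n))// add0n /t expr0.
  by rewrite -[leRHS]mulr1 ler_wpM2l ?mulr_ge0 ?ltW// gerBl ltW// t0.
have [U [UU oU]] := @ultraFilterLemma nat \oo _.
(* Coordinates are not yet known to be continuous, but each is controlled by a one-element subset
   sum, so limits along an ultrafilter exist. *)
have /choice[a aP] : forall i, exists b : K^o, (fun k => co (x - y k) i : K^o) @ U --> b.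
  move=> i; apply: (@ultra_cvg_scalar _ _ _ _ _ (2 * L / nm (e i))) => //.
  apply: nearW => k; rewrite ler_pdivlMr ?nm_gt0 ?basis_neq0// nm_coordinate.
  exact: xyB.
have psum_lim F n : (fun k => psum F n (x - y k)) @ U -->
    \sum_(0 <= i < n | F i) a i *: e i.
  by apply: cvg_bigsum => i _; apply: cvg_nmZ; exact: aP.
have ax : a = co x.
  apply/coP/cvg_nmP => d d0; pose c := d / 3 / (2 * L + 1).
  have c0 : 0 < c by rewrite !divr_gt0// ltr_wpDl ?mulr_ge0 ?ltW.
  have [m tm] : exists m, t m < c.
    have [N _ /(_ N (leqnn N)) /= Nc] := near_infty_natSinv_lt (PosNum c0).
    exists N; rewrite (le_lt_trans _ Nc)// /t exprVn lef_pV2 ?posrE ?exprn_gt0//.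
    by rewrite -natrX ler_nat ltn_expl.
  have /cvg_nmP/(_ (d / 3)) := @psum_cvg (x - y m).
  case=> [|N _ Nx]; first by rewrite divr_gt0.
  exists N => // n Nn; have := Nx n Nn => /= xmn.
  have lim : (fun k => x - psum xpredT n (x - y k)) @ U --> x - series (fun i => a i *: e i) n.
    by apply: cvgB; [exact: cvg_cst|exact: psum_lim].
  (* Exchange of limits: the fixed vector x - [y m] has a convergent expansion, and the partial sums
     of [y m] - [y k] are at most 2 L [t m], uniformly in k and n. *)
  rewrite (@le_lt_trans _ _ (t m + d / 3 + 2 * L * t m))//.
    apply: (cvg_nm_le lim); apply: oU; exists m => // k /= mk.
    have -> : x - psum xpredT n (x - y k) = y m + (x - y m - psum xpredT n (x - y m)) -
        psum xpredT n (y m - y k).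
      have -> : psum xpredT n (x - y k) = psum xpredT n (x - y m) + psum xpredT n (y m - y k).
        by rewrite !psumB subrKA.
      by rewrite opprD !addrA [y m + x]addrC addrK.
    rewrite (le_trans (nmB _ _))// lerD//.
      by rewrite (le_trans (nmD _ _))// lerD// ltW.
    have := yB m (k - m)%N xpredT n; rewrite subnKC// => /le_trans; apply.
    by rewrite ler_pM2l ?mulr_gt0// gerBl ltW.
  have : (2 * L + 1) * t m < d / 3 by rewrite mulrC -ltr_pdivlMr// ltr_wpDl ?mulr_ge0 ?ltW.
  by lra.
move=> F n; have := psum_lim F n; rewrite ax => /cvg_nm_le; apply.
by apply: nearW => k; exact: xyB.
Qed.

Lemma unconditional_psum_bound : unconditional_basis e ->
  exists2 C : R, 0 <= C & forall F n x, nm (psum F n x) <= C * nm x.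
Proof.
move=> [_ uc]; apply: psum_bound => x.
have /uc/unconditional_bounded[M MP] : cvgn (series (fun n => co x n *: e n)).
  by apply/cvg_ex; exists x; exact: psum_cvg.
by exists M => F n; exact: MP.
Qed.

End Basis.

Arguments psum {R s X} e co F n x.

(** * Partial sum operators and coordinate functionals *)

Section Projections.
Context {R : realType} {s : scalars}.
Local Notation K := (scalar_field R s).
Context {X : completeNormedModType K} {e : nat -> X} {co : X -> nat -> K}.
Context (coP : coordinates e co).
Local Notation ps := (psum e co).

Lemma coordinate_psum F n x i :
  co (ps F n x) i = if (i < n)%N && F i then co x i else 0.
Proof.
suff <- : (fun i => if (i < n)%N && F i then co x i else 0) = co (ps F n x) by [].
apply/coP; apply/cvg_nmP => d d0; exists n => // m /= nm_.
suff E : \sum_(0 <= i < m) (if (i < n)%N && F i then co x i else 0) *: e i =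
    ps F n x by rewrite /series /= E subrr nm0.
rewrite (big_cat_nat (n := n))//= [X in _ + X]big_nat [X in _ + X]big1 ?addr0 => [|j].
  rewrite /psum big_nat [RHS]big_mkcond [RHS]big_nat; apply: eq_bigr => j /andP[_ jn].
  by rewrite jn; case: (F j) => //=; rewrite scale0r.
by move=> /andP[nj _]; rewrite ltnNge nj scale0r.
Qed.

Lemma psum_psum n m x : ps xpredT n (ps xpredT m x) = ps xpredT (minn n m) x.
Proof.
rewrite {1 3}/psum; have [nm_|mn] := leqP n m.
  apply: eq_big_nat => i /andP[_ ni]; rewrite coordinate_psum andbT.
  by rewrite (leq_trans ni nm_).
rewrite (big_cat_nat (n := m))//=; last exact: ltnW.
rewrite [X in _ + X]big_nat [X in _ + X]big1 ?addr0 => [|j /andP[mj _]]; last first.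
  by rewrite coordinate_psum andbT ltnNge mj scale0r.
by apply: eq_big_nat => i /andP[_ im]; rewrite coordinate_psum andbT im.
Qed.

(** Selecting among consecutive disjoint blocks amounts to selecting indices, so the bound on subset
    sums also controls sums of block projections. *)
Lemma psum_blocks (nk : nat -> nat) (G : pred nat) m :
  {homo nk : i j / (i <= j)%N} -> exists F, forall x,
  \sum_(0 <= k < m | G k) (ps xpredT (nk k.+1) x - ps xpredT (nk k) x) =
  ps F (nk m) x.
Proof.
move=> nk_homo; elim: m => [|m [F IH]].
  exists xpred0 => x; rewrite big_geq// /psum big1//.
exists (fun i => if (i < nk m)%N then F i else G m) => x.
have nkm : (nk m <= nk m.+1)%N by exact: nk_homo.
have -> : ps (fun i => if (i < nk m)%N then F i else G m) (nk m.+1) x =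
    ps F (nk m) x + (if G m then \sum_(nk m <= i < nk m.+1) co x i *: e i else 0).
  rewrite /psum (big_cat_nat (n := nk m))//=; congr (_ + _).
    rewrite big_mkcond [RHS]big_mkcond big_nat [RHS]big_nat.
    by apply: eq_bigr => i /andP[_ ->].
  rewrite big_mkcond; case: ifPn => Gm.
    by apply: eq_big_nat => i /andP[mi _]; rewrite ltnNge mi.
  by rewrite big_nat big1// => i /andP[mi _]; rewrite ltnNge mi.
rewrite big_mkcond big_nat_recr//= -big_mkcond IH; congr (_ + _).
case: ifP => // _; rewrite /psum [in LHS](big_cat_nat (n := nk m))//=.
by rewrite addrAC subrr add0r.
Qed.

Context {C : R} (C0 : 0 <= C) (psum_le : forall F n x, nm (ps F n x) <= C * nm x).

Lemma partial_sum_operators : exists P : nat -> bop X X,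
  forall n x, P n x = ps xpredT n x.
Proof.
suff /choice[P PE] : forall n, exists P : bop X X, forall x, P x = ps xpredT n x.
  by exists P.
move=> n; have [P PE _] := bopP (psum_linear coP xpredT n) C0 (psum_le xpredT n).
by exists P => x; rewrite -PE.
Qed.

Lemma coordinate_functionals : exists f : nat -> dual X, forall i x, f i x = co x i.
Proof.
suff /choice[f fE] : forall i, exists f : dual X, forall x, f x = co x i.
  by exists f.
move=> i; have ei := nm_gt0 (basis_neq0 coP i).
have lin : linear (fun x => co x i : K^o) by move=> k x y; exact: coordinate_linear.
have [||f fE _] := bopP lin (M := C / nm (e i)).
- by rewrite divr_ge0 ?nm_ge0.
- by move=> x; rewrite mulrAC ler_pdivlMr// nm_coordinate.
by exists f => x; rewrite -fE.
Qed.

End Projections.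

(** * Reflexivity *)

Section Reflexive.
Context {R : realType} {s : scalars}.
Local Notation K := (scalar_field R s).

(** The limits of phi (f t) along U depend linearly and boundedly on phi, so they form an element of
    the bidual, which reflexivity represents by a vector. *)
Lemma reflexive_ultra (X : completeNormedModType K) (T : Type)
    (U : set_system T) (f : T -> X) M : UltraFilter U -> reflexive_space X ->
  (\forall t \near U, nm (f t) <= M) ->
  exists x : X, forall phi : dual X, (fun t => phi (f t)) @ U --> phi x.
Proof.
move=> UU Xrefl fM.
have M0 : 0 <= M.
  by have [t] := filter_ex fM; apply: le_trans; exact: nm_ge0.
have phiM (phi : dual X) : \forall t \near U, nm (phi (f t)) <= M * nm phi.
  apply: filterS fM => t tM; rewrite (le_trans (nm_bop phi _))// mulrC.
  by rewrite ler_wpM2r// nm_ge0.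
have cP (phi : dual X) : exists b : K^o, (fun t => phi (f t)) @ U --> b.
  exact: (@ultra_cvg_scalar _ _ _ _ _ _ UU (phiM phi)).
have [Phi PhiP] := choice cP.
have lin : linear Phi.
  move=> k phi psi; apply: (@cvg_nm_unique _ _ K^o _ U _ (fun t => (k *: phi + psi) (f t))).
  - exact: PhiP.
  - have -> : (fun t => (k *: phi + psi) (f t)) =
        (fun t => k *: phi (f t) + psi (f t)) by [].
    apply: (@cvgD _ K^o); last exact: (PhiP psi).
    by apply: (@cvgZl_tmp _ K^o); exact: (PhiP phi).
have [|Phi' PhiE _] := bopP lin (M := M) M0.
  by move=> phi; exact: (cvg_nm_le (PhiP phi)).
have [x xP] := Xrefl Phi'; exists x => phi.
by rewrite -xP -PhiE.
Qed.

Context {X : completeNormedModType K} {e : nat -> X} {co : X -> nat -> K}.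
Context (coP : coordinates e co) (P : nat -> bop X X) (f : nat -> dual X) (C : R).
Hypothesis PE : forall n x, P n x = psum e co xpredT n x.
Hypothesis fE : forall i x, f i x = co x i.
Hypothesis PC : forall n x, nm (P n x) <= C * nm x.

(** Otherwise there are bounded vectors [v N] with first N coordinates zero and |psi ([v N])| >= d.
    Their weak limit along an ultrafilter has all coordinates zero, hence is 0, against |psi x| >=
    d. *)
Lemma reflexive_shrinking (psi : dual X) (d : R) : reflexive_space X -> 0 < d ->
  exists N, forall n x, (N <= n)%N -> nm (psi (x - P n x)) <= d * nm x.
Proof.
move=> Xrefl d0; apply: contrapT => /forallNP nN.
have /choice[v vP] : forall N, exists v : X,
    [/\ nm v <= 1 + C, forall i, (i < N)%N -> co v i = 0 & d <= nm (psi v)].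
  move=> N; have /existsNP[n /existsNP[x /not_implyP[Nn /negP]]] := nN N.
  rewrite -ltNge => xd.
  have x0 : x != 0.
    by apply: contraTneq xd => ->; rewrite linear0 subrr linear0 !nm0 mulr0 ltxx.
  have nx := nm_gt0 x0; pose u := ofR (nm x)^-1 *: x.
  have u1 : nm u = 1 by rewrite nmZR gtr0_norm ?invr_gt0// mulVf ?gt_eqF.
  exists (u - P n u); split.
  - by rewrite (le_trans (nmB _ _))// -[C]mulr1 -u1 lerD2l.
  - move=> i iN; rewrite -fE linearB /= !fE PE coordinate_psum// andbT.
    by rewrite (leq_trans iN Nn) subrr.
  - rewrite /u linearZ -scalerBr linearZ nmZR gtr0_norm ?invr_gt0//.
    by rewrite mulrC ler_pdivlMr// ltW.
have [U [UU oU]] := @ultraFilterLemma nat \oo _.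
have [|x xP] := @reflexive_ultra X _ U v (1 + C) UU Xrefl.
  by apply: nearW => N; have [] := vP N.
have x0 : x = 0.
  have fx i : co x i = 0.
    rewrite -fE; apply: (@cvg_nm_unique _ _ K^o _ U _ (fun t => f i (v t))).
    - exact: xP.
    - apply/cvg_nmP => r r0; apply: oU; exists i.+1 => // N /= iN.
      by have [_ v0 _] := vP N; rewrite fE v0// subrr nm0.
  apply: (cvg_nm_unique (@psum_cvg _ _ _ _ _ coP x)).
  apply/cvg_nmP => r r0; apply: nearW => n.
  by rewrite /psum big1 ?subrr ?nm0// => i _; rewrite fx scale0r.
have : d <= nm (psi x).
  by apply: (cvg_nm_ge (xP psi)); apply: nearW => N; have [] := vP N.
by rewrite x0 linear0 nm0 leNgt d0.
Qed.

End Reflexive.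

(** * The gliding hump *)

Section Multipliers.
Context {R : realType} {s : scalars}.
Local Notation K := (scalar_field R s).

(** The scalar i is 0 in the real case and the imaginary unit in the complex one, so both cases
    share one proof afterwards. *)
Lemma scalar_decomposition : exists i : K, nm (i : K^o) <= 1 /\
  forall a : K, exists re im : R, [/\ a = ofR re + i * ofR im,
    `|re| <= nm (a : K^o) & `|im| <= nm (a : K^o)].
Proof.
rewrite /nm /toR /ofR; case: (s) => /=.
  exists 0; split=> [|a]; first by rewrite normr0.
  by exists a, 0; rewrite mul0r addr0 normr0.
exists 'i%C; split=> [|[c d]].
  by rewrite /Normc.normc /= expr0n expr1n add0r sqrtr1.
exists c, d; rewrite /Normc.normc /= -!sqrtr_sqr; split.
- by apply/eqP; rewrite eq_complex /= !(mul0r, mul1r, mulr0, addr0, add0r, subr0) !eqxx.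
- by rewrite ler_wsqrtr// lerDl sqr_ge0.
- by rewrite ler_wsqrtr// lerDr sqr_ge0.
Qed.

Section Vectors.
Context {V : normedModType K}.
Implicit Types (u : nat -> V) (D : R).

Lemma nm_convex (x y : V) (c : R) D : 0 <= c <= 1 -> nm x <= D -> nm y <= D ->
  nm (ofR c *: x + ofR (1 - c) *: y) <= D.
Proof.
move=> /andP[c0 c1] xD yD; rewrite (le_trans (nmD _ _))// !nmZR.
rewrite !ger0_norm ?subr_ge0//; nra.
Qed.

(** The sum is affine in each coefficient, so each can be pushed to 0 or 1 by convexity. The
    induction needs an offset z, which absorbs the terms already treated. *)
Lemma nm_unit_multiplier u m D (c : nat -> R) :
  (forall F : pred nat, nm (\sum_(0 <= j < m | F j) u j) <= D) ->
  (forall j, 0 <= c j <= 1) -> nm (\sum_(0 <= j < m) ofR (c j) *: u j) <= D.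
Proof.
move=> uD c01; suff gen (z : V) :
    (forall F : pred nat, nm (z + \sum_(0 <= j < m | F j) u j) <= D) ->
    nm (z + \sum_(0 <= j < m) ofR (c j) *: u j) <= D.
  by rewrite -[X in nm X]add0r; apply: gen => F; rewrite add0r.
elim: m z {uD} => [|m IH] z zD.
  by have := zD xpredT; rewrite !big_geq.
rewrite big_nat_recr//=; set w := \sum_(_ <= _ < _) _.
have -> : z + (w + ofR (c m) *: u m) =
    ofR (c m) *: (z + u m + w) + ofR (1 - c m) *: (z + w).
  have -> : ofR (1 - c m) = 1 - ofR (c m) :> K.
    by apply/eqP; rewrite eq_sym subr_eq -ofRD subrK ofR1.
  by rewrite scalerBl scale1r [z + u m + w]addrAC [in RHS]scalerDr [RHS]addrC subrKA addrA.
apply: nm_convex => //; apply: IH => F.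
  have := zD (fun j => if (j < m)%N then F j else true).
  rewrite big_mkcond big_nat_recr//= ltnn addrAC addrA big_nat [in X in _ -> X]big_mkcond.
  rewrite [in X in _ -> X]big_nat; congr (nm (_ + _ + _) <= _).
  by apply: eq_bigr => j /andP[_ ->].
have := zD (fun j => if (j < m)%N then F j else false).
rewrite big_mkcond big_nat_recr//= ltnn addr0 big_nat [in X in _ -> X]big_mkcond.
rewrite [in X in _ -> X]big_nat; congr (nm (_ + _) <= _).
by apply: eq_bigr => j /andP[_ ->].
Qed.

(** A real multiplier bounded by M is 2M c - M with c valued in [0, 1], which costs 3 M D; real and
    imaginary parts double this. *)
Lemma nm_multiplier u m D (a : nat -> K) M :
  (forall F : pred nat, nm (\sum_(0 <= j < m | F j) u j) <= D) ->
  (forall j, nm (a j : K^o) <= M) ->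
  nm (\sum_(0 <= j < m) a j *: u j) <= 6 * M * D.
Proof.
move=> uD aM; have M0 : 0 <= M by rewrite (le_trans _ (aM 0%N)) ?nm_ge0.
have D0 : 0 <= D by rewrite (le_trans _ (uD xpred0)) ?nm_ge0.
have realcase (r : nat -> R) : (forall j, `|r j| <= M) ->
    nm (\sum_(0 <= j < m) ofR (r j) *: u j) <= 3 * M * D.
  (* If M = 0, division by 0 makes c vanish, as does r. *)
  move=> rM; pose c j := (r j + M) / (2 * M).
  have rE j : r j = 2 * M * c j - M.
    have [M0'|Mn0] := eqVneq M 0; last by rewrite /c; field.
    have := rM j; rewrite M0' normr_le0 => /eqP ->.
    by rewrite mulr0 mul0r subr0.
  have -> : \sum_(0 <= j < m) ofR (r j) *: u j =
      ofR (2 * M) *: (\sum_(0 <= j < m) ofR (c j) *: u j) +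
      ofR (- M) *: (\sum_(0 <= j < m) u j).
    rewrite !scaler_sumr -big_split; apply: eq_bigr => j _ /=.
    by rewrite scalerA -scalerDl -ofRM -ofRD -rE.
  rewrite (le_trans (nmD _ _))// !nmZR normrN !ger0_norm ?mulr_ge0//.
  have h1 : nm (\sum_(0 <= j < m) ofR (c j) *: u j) <= D.
    apply: nm_unit_multiplier => // j; have := rM j; rewrite ler_norml => /andP[r1 r2].
    have [M0'|Mn0] := eqVneq M 0; first by rewrite /c M0' mulr0 invr0 mulr0 lexx ler01.
    have M0'' : 0 < M by rewrite lt_def Mn0.
    rewrite /c divr_ge0 ?mulr_ge0//=; last lra.
    by rewrite ler_pdivrMr ?mulr_gt0//; lra.
  have := uD xpredT; nra.
have [i [i1 /choice[re reP]]] := scalar_decomposition.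
have [im imP] := choice reP.
have -> : \sum_(0 <= j < m) a j *: u j =
    \sum_(0 <= j < m) ofR (re (a j)) *: u j +
    i *: \sum_(0 <= j < m) ofR (im (a j)) *: u j.
  rewrite scaler_sumr -big_split; apply: eq_bigr => j _ /=.
  by have [aE _ _] := imP (a j); rewrite {1}aE scalerDl scalerA.
rewrite (le_trans (nmD _ _))// nmZ.
have := realcase (fun j => re (a j)) => /(_ _)/= h1.
have h2 := realcase (fun j => im (a j)).
have {}h1 : nm (\sum_(0 <= j < m) ofR (re (a j)) *: u j) <= 3 * M * D.
  by apply: h1 => j; have [_ + _] := imP (a j) => /le_trans; apply.
have {}h2 : nm (\sum_(0 <= j < m) ofR (im (a j)) *: u j) <= 3 * M * D.
  by apply: h2 => j; have [_ _] := imP (a j) => /le_trans; apply.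
have := nm_ge0 (\sum_(0 <= j < m) ofR (im (a j)) *: u j).
have := @nm_ge0 _ _ K^o i; nra.
Qed.

(* Averaging over all signs removes the off-diagonal terms. *)
Lemma nm_sign_average (b : nat -> nat -> V) m D :
  (forall eps : nat -> bool, nm (\sum_(0 <= i < m) \sum_(0 <= j < m)
     (if eps i == eps j then b i j else - b i j)) <= D) ->
  nm (\sum_(0 <= i < m) b i i) <= D.
Proof.
move=> bD; suff gen (z : V) : (forall eps : nat -> bool,
    nm (z + \sum_(0 <= i < m) \sum_(0 <= j < m)
      (if eps i == eps j then b i j else - b i j)) <= D) ->
    nm (z + \sum_(0 <= i < m) b i i) <= D.
  by rewrite -[X in nm X]add0r; apply: gen => eps; rewrite add0r.
elim: m z {bD} => [|m IH] z zD.
  by have := zD xpredT; rewrite !big_geq.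
rewrite big_nat_recr//= [_ + b m m]addrC addrA; apply: IH => eps.
set S := \sum_(_ <= _ < _) _.
(* These are the cross terms involving the index m. Reversing the last sign t changes c to -c, so
   the mean over t removes them. *)
pose c := \sum_(0 <= i < m) (if eps i then b i m else - b i m) +
          \sum_(0 <= j < m) (if eps j then b m j else - b m j).
have key (t : bool) : nm (z + b m m + S + (if t then c else - c)) <= D.
  have := zD (fun i => if (i < m)%N then eps i else t).
  rewrite big_nat_recr//= big_nat_recr//= eqxx.
  under eq_big_nat => i /andP[_ im].
    rewrite big_nat_recr//= im ltnn.
    under eq_big_nat => j /andP[_ jm] do rewrite jm.
    over.
  under [X in _ + (X + _)]eq_big_nat => j /andP[_ jm] do rewrite jm ltnn.
  rewrite big_split /= -/S; apply: le_trans; rewrite le_eqVlt; apply/orP; left.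
  apply/eqP; congr nm.
  have -> : (if t then c else - c) =
      \sum_(0 <= i < m) (if eps i == t then b i m else - b i m) +
      \sum_(0 <= j < m) (if t == eps j then b m j else - b m j).
    rewrite /c; case: t; first by congr (_ + _); apply: eq_bigr => i _; case: (eps i).
    rewrite opprD -!sumrN; congr (_ + _); apply: eq_bigr => i _; case: (eps i) => //=;
      by rewrite opprK.
  rewrite -!addrA; congr (_ + _); rewrite addrCA; congr (_ + _).
  by rewrite addrC -addrA.
have -> : z + b m m + S = ofR (2^-1) *: (z + b m m + S + c) +
    ofR (1 - 2^-1) *: (z + b m m + S - c).
  have -> : (1 - 2^-1 : R) = 2^-1 by lra.
  set y := z + b m m + S; rewrite -scalerDr [y + c + _]addrACA subrr addr0.
  by rewrite scalerDr -scalerDl -ofRD [X in ofR X](_ : _ = 1) ?ofR1 ?scale1r//; lra.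
apply: nm_convex; [lra|exact: (key true)|exact: (key false)].
Qed.

End Vectors.
End Multipliers.

(** * Tails of finite-rank operators *)

Section FiniteRank.
Context {R : realType} {s : scalars}.
Local Notation K := (scalar_field R s).
Context {X : completeNormedModType K} {e : nat -> X} {co : X -> nat -> K}.
Context (P : nat -> bop X X) (f : nat -> dual X).
Hypothesis PE : forall n x, P n x = psum e co xpredT n x.
Hypothesis fE : forall i x, f i x = co x i.
Hypothesis shrinking : forall (psi : dual X) (d : R), 0 < d ->
  exists N, forall n x, (N <= n)%N -> nm (psi (x - P n x)) <= d * nm x.

(** Each coordinate of T is a functional, whose tails are small because the basis is shrinking;
    [P n] involves only n coordinates. *)
Lemma finite_rank_tail (T : bop X X) n (d : R) : 0 < d ->
  exists N, forall r x, (N <= r)%N -> nm (P n (T (x - P r x))) <= d * nm x.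
Proof.
elim: n d => [|n IH] d d0.
  exists 0%N => r x _; rewrite PE /psum big_geq// nm0 mulr_ge0 ?nm_ge0 ?ltW//.
have d2 : 0 < d / 2 by rewrite divr_gt0.
have en : 0 < nm (e n) + 1 by rewrite ltr_wpDl ?nm_ge0.
have [N NP] := IH _ d2.
have [M MP] := shrinking (bop_comp (f n) T) (divr_gt0 d2 en).
exists (maxn N M) => r x; rewrite geq_max => /andP[Nr Mr].
rewrite PE /psum big_nat_recr//= -/(psum e co xpredT n _) -PE (le_trans (nmD _ _))//.
rewrite [d]splitr mulrDl lerD ?NP// nmZ -fE.
rewrite (@le_trans _ _ (d / 2 / (nm (e n) + 1) * nm x * (nm (e n) + 1)))//.
  by apply: ler_pM; rewrite ?nm_ge0// ?lerDl//; exact: MP.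
by rewrite mulrAC divfK ?gt_eqF.
Qed.

End FiniteRank.

(** * Block-diagonal operators and the copy of c0 *)

Section C0Step.
Context {R : realType} {s : scalars}.
Local Notation K := (scalar_field R s).

Lemma bop_sumE (V W : normedModType K) (I : Type) (r : seq I) (Q : pred I)
    (T : I -> bop V W) x : (\sum_(i <- r | Q i) T i) x = \sum_(i <- r | Q i) T i x.
Proof.
elim: r => [|i r IH]; first by rewrite !big_nil.
by rewrite !big_cons; case: ifP => // _; rewrite bopD IH.
Qed.

Lemma cvg_bop_eval (V W : normedModType K) (T : Type) (F : set_system T)
    {FF : Filter F} (S : T -> bop V W) (S0 : bop V W) x :
  S @ F --> S0 -> (fun t => S t x) @ F --> S0 x.
Proof.
move=> /cvg_nmP FS; apply/cvg_nmP => d d0.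
have x1 : 0 < nm x + 1 by rewrite ltr_wpDl ?nm_ge0.
apply: filterS (FS _ (divr_gt0 d0 x1)) => t; rewrite ltr_pdivlMr// => h.
rewrite -[_ - _]/((S0 - S t) x) (le_lt_trans (nm_bop _ _))// (le_lt_trans _ h)//.
by rewrite ler_wpM2l ?nm_ge0// lerDl.
Qed.

Context {X : completeNormedModType K} (P : nat -> bop X X) (C : R).
Hypothesis C0 : 0 <= C.
Hypothesis PC : forall n x, nm (P n x) <= C * nm x.
Hypothesis P_cvg : forall x, (fun n => P n x) @ \oo --> x.
Hypothesis PP : forall n m x, P n (P m x) = P (minn n m) x.
Hypothesis P_blocks : forall (nk : nat -> nat) (G : pred nat) m x,
  {homo nk : i j / (i <= j)%N} ->
  nm (\sum_(0 <= k < m | G k) (P (nk k.+1) x - P (nk k) x)) <= C * nm x.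

Section BlockDiagonal.
Context (T : bop X X) (nk : nat -> nat).
Hypothesis nk_homo : {homo nk : i j / (i <= j)%N}.

Context (Q W : nat -> bop X X).
Hypothesis QE : forall k x, Q k x = P (nk k.+1) x - P (nk k) x.
Hypothesis WE : forall k x, W k x = Q k (T (Q k x)).

Lemma block_orth j k x : Q j (Q k x) = if j == k then Q k x else 0.
Proof.
have le i j' : (i <= j')%N -> forall y, P (nk i) (P (nk j') y) = P (nk i) y.
  by move=> ij y; rewrite PP (minn_idPl _)// nk_homo.
have ge i j' : (j' <= i)%N -> forall y, P (nk i) (P (nk j') y) = P (nk j') y.
  by move=> ij y; rewrite PP (minn_idPr _)// nk_homo.
rewrite !QE (linearB (P (nk j.+1))) (linearB (P (nk j))) /=.
case: (ltngtP j k) => [jk|kj|->].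
- by rewrite !le; [rewrite !subrr|lia..].
- by rewrite !ge; [rewrite subrr|lia..].
- by rewrite (ge k.+1 k.+1)// (ge k.+1 k)// (le k k.+1)// (le k k)// subrr subr0.
Qed.

Lemma nm_block_signs (F eps : pred nat) m x :
  nm (\sum_(0 <= k < m | F k) (if eps k then Q k x else - Q k x)) <=
  2 * C * nm x.
Proof.
rewrite (bigID eps)/= (eq_bigr (Q ^~ x)) => [|k /andP[_ ->]//].
rewrite [X in _ + X](eq_bigr (fun k => - Q k x)) => [|k /andP[_ /negPf ->]//].
rewrite sumrN (le_trans (nmB _ _))// mulrDl mul1r mulrDl.
under eq_bigr do rewrite QE; under [X in _ + nm X]eq_bigr do rewrite QE.
by rewrite lerD//; exact: P_blocks.
Qed.

(** The diagonal terms Q_i T Q_i are the average over signs of the sums of eps_i eps_j Q_i T Q_j.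
    Each such sum factors as D T D, with D the signed sum of the blocks, of norm at most 2C. *)
Lemma nm_block_diag_subset (F : pred nat) m x :
  nm (\sum_(0 <= k < m | F k) W k x) <= 4 * C * C * nm T * nm x.
Proof.
pose b i j := if F i && F j then Q i (T (Q j x)) else 0.
rewrite big_mkcond (eq_bigr (fun i => b i i)) => [|i _]; last first.
  by rewrite /b andbb WE.
apply: nm_sign_average => eps.
have -> : \sum_(0 <= i < m) \sum_(0 <= j < m) (if eps i == eps j then b i j else - b i j) =
    \sum_(0 <= i < m | F i) (if eps i then Q i (T (\sum_(0 <= j < m | F j)
        (if eps j then Q j x else - Q j x))) else
        - Q i (T (\sum_(0 <= j < m | F j) (if eps j then Q j x else - Q j x)))).
  rewrite [RHS]big_mkcond; apply: eq_bigr => i _.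
  rewrite /b; case: (F i) => /=; last first.
    by rewrite big1// => j _; case: ifP; rewrite ?oppr0.
  case: (eps i); rewrite !linear_sum /= -?sumrN [RHS]big_mkcond;
    apply: eq_bigr => j _; case: (F j); case: (eps j);
    by rewrite //= ?oppr0// !linearN ?opprK.
rewrite (le_trans (nm_block_signs _ _ _ _))//.
have h := nm_block_signs F eps m x.
rewrite -!mulrA -[4 in leRHS](_ : 2 * 2 = _ :> R); last by rewrite -natrM.
rewrite -mulrA ler_wpM2l// mulrCA ler_wpM2l//.
rewrite (le_trans (nm_bop T _))// mulrCA mulrA mulrC.
by have := ler_wpM2l (nm_ge0 T) h; lra.
Qed.

(** The constant is the 6 of general multipliers times the 4 of subset sums. *)
Lemma nm_block_diag m (a : nat -> K) M : (forall j, nm (a j : K^o) <= M) ->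
  nm (\sum_(0 <= j < m) a j *: W j) <= 24 * C * C * nm T * M.
Proof.
move=> aM; have M0 : 0 <= M by rewrite (le_trans _ (aM 0%N)) ?nm_ge0.
apply: nm_bop_le => [|x]; first by rewrite !mulr_ge0 ?nm_ge0.
rewrite bop_sumE.
have := nm_multiplier (fun F => nm_block_diag_subset F m x) aM.
move=> /le_trans; apply; rewrite le_eqVlt; apply/orP; left; apply/eqP; ring.
Qed.

End BlockDiagonal.

Hypothesis P_tail : forall (T : bop X X) n (d : R), 0 < d ->
  exists N, forall r x, (N <= r)%N -> nm (P n (T (x - P r x))) <= d * nm x.

Lemma P_cvg_le x (d : R) : 0 < d ->
  exists N, forall n, (N <= n)%N -> nm (x - P n x) <= d.
Proof.
by move=> d0; have /cvg_nmP/(_ _ d0)[N _ NP] := @P_cvg x; exists N => n /NP/ltW.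
Qed.

(* Otherwise vectors [xk] escaping along the basis would satisfy
   [|A T B xk| >= d], and [a |-> sum_k a_k Q_k T Q_k], with [Q_k] a block
   projection almost fixing [B xk] and [T B xk], would be a copy of c0 on which
   [bop_mult A B] is an isomorphism. *)
Lemma c0_singular_tail (A B T : bop X X) (d : R) :
  c0_singular (bop_mult A B) -> 0 < d ->
  exists N, forall r x, (N <= r)%N -> nm (A (T (B (x - P r x)))) <= d * nm x.
Proof.
move=> ABsing d0; apply: contrapT => /forallNP nN.
pose C' := 24 * C * C * nm T.
have C'0 : 0 <= C' by rewrite !mulr_ge0 ?nm_ge0.
(* H gathers the factors of all perturbation errors below, so that d' H = d/4 dominates each of
   them. *)
pose H := nm A * (2 + 4 * C * nm T) + 2 * nm A * C' + 1.
have A0 := nm_ge0 A; have T0 := nm_ge0 T.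
have H0 : 0 < H by rewrite ltr_wpDl// !(addr_ge0, mulr_ge0).
pose d' := d / 4 / H.
have d'0 : 0 < d' by rewrite !divr_gt0.
have step n : exists p : X * nat, [/\ (n <= p.2)%N,
    nm p.1 <= 1 + C /\ d <= nm (A (T (B p.1))),
    nm (P n (B p.1)) <= d' /\ nm (P n (T (B p.1))) <= d' &
    nm (B p.1 - P p.2 (B p.1)) <= d' /\ nm (T (B p.1) - P p.2 (T (B p.1))) <= d'].
  (* Far along the basis, z = u - P_r u has images B z and T B z with negligible part below n; the
     next index is then taken so large that both are almost exhausted. *)
  have [N1 NP1] := P_tail B n d'0; have [N2 NP2] := P_tail (bop_comp T B) n d'0.
  have /existsNP[r /existsNP[x /not_implyP[Nr /negP]]] := nN (maxn N1 N2).
  rewrite -ltNge => xd; move: Nr; rewrite geq_max => /andP[N1r N2r].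
  have x0 : x != 0.
    by apply: contraTneq xd => ->; rewrite linear0 subrr !linear0 !nm0 mulr0 ltxx.
  have nx := nm_gt0 x0; pose u := ofR (nm x)^-1 *: x.
  have u1 : nm u = 1 by rewrite nmZR gtr0_norm ?invr_gt0// mulVf ?gt_eqF.
  pose z := u - P r u.
  have [M1 MP1] := P_cvg_le (B z) d'0; have [M2 MP2] := P_cvg_le (T (B z)) d'0.
  exists (z, maxn n (maxn M1 M2)); split=> /=.
  - exact: leq_maxl.
  - split; first by rewrite (le_trans (nmB _ _))// -[C]mulr1 -u1 lerD2l.
    rewrite /z /u linearZ -scalerBr !linearZ nmZR gtr0_norm ?invr_gt0//.
    by rewrite mulrC ler_pdivlMr// ltW.
  - by have := NP1 r u N1r; have := NP2 r u N2r; rewrite u1 mulr1.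
  - by split; [apply: MP1|apply: MP2]; rewrite !leq_max leqnn ?orbT.
have /choice[g gP] := step.
pose nk := fix nk k := if k is k'.+1 then (g (nk k')).2 else 0%N.
have nk_homo : {homo nk : i j / (i <= j)%N}.
  by apply: homo_leq => // [i j k|i]; [exact: leq_trans|have [] := gP (nk i)].
have [Q QE] : exists Q : nat -> bop X X,
    forall k y, Q k y = P (nk k.+1) y - P (nk k) y.
  by exists (fun k => P (nk k.+1) - P (nk k)).
have [W WE] : exists W : nat -> bop X X, forall k y, W k y = Q k (T (Q k y)).
  by exists (fun k => bop_comp (Q k) (bop_comp T (Q k))).
have [|J JP] := @c0_series _ _ (bop X X) W C' C'0.
  by move=> m a M; exact: (nm_block_diag nk_homo QE WE).
have JC a : nm (J a) <= C' * nm a.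
  apply: (cvg_nm_le (JP a)); apply: nearW => m.
  by apply: (nm_block_diag nk_homo QE WE) => j; exact: nm_c0.
have JQ a k y : J a (Q k y) = a k *: Q k (T (Q k y)).
  apply: (cvg_nm_unique (cvg_bop_eval (JP a))).
  apply/cvg_nmP => c c0'; exists k.+1 => // m /= km.
  rewrite /series /= bop_sumE (bigD1_seq k) ?mem_index_iota ?iota_uniq//=.
  rewrite big1 => [|j jk]; last first.
    rewrite -[LHS]/(a j *: W j (Q k y)) WE (block_orth nk_homo QE) (negPf jk).
    by rewrite !linear0.
  rewrite addr0 -[X in _ - X]/(a k *: W k (Q k y)) WE (block_orth nk_homo QE).
  by rewrite eqxx subrr nm0.
have Qle k y : nm (Q k y) <= 2 * C * nm y.
  rewrite QE (le_trans (nmB _ _))//.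
  by rewrite mulrDl mul1r mulrDl lerD.
have Qclose k y : nm (P (nk k) y) <= d' -> nm (y - P (nk k.+1) y) <= d' ->
    nm (y - Q k y) <= 2 * d'.
  move=> y1 y2; rewrite QE.
  by rewrite opprB addrA addrAC (le_trans (nmD _ _))// mulrDl mul1r lerD.
(* Testing [J a] at the k-th vector: A (J a) B x_k is close to a_k A Q_k T Q_k B x_k, whose norm is
   at least |a_k| (d - d/4). The mismatch between B x_k and its block costs d/4 |a|. *)
have lower (a : c0 K) k : nm (a k : K^o) * (3 / 4 * d) <=
    nm (bop_mult A B (J a)) * (1 + C) + d / 4 * nm a.
  have [_ [xk1 xkd] [Pw PTw] [Pw' PTw']] := gP (nk k).
  set w := B (g (nk k)).1 in xkd Pw PTw Pw' PTw'.
  have wQ : nm (w - Q k w) <= 2 * d' by exact: Qclose.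
  have TwQ : nm (T w - Q k (T w)) <= 2 * d' by exact: Qclose.
  have h1 : nm (T w - Q k (T (Q k w))) <= 2 * d' + 2 * C * nm T * (2 * d').
    rewrite (le_trans (nm_dist _ (Q k (T w)) _))// lerD// -linearB /=.
    rewrite -linearB /= (le_trans (Qle _ _))// -[leRHS]mulrA ler_wpM2l ?mulr_ge0//.
    by rewrite (le_trans (nm_bop _ _))// ler_wpM2l.
  have h2 : d - nm A * (2 * d' + 2 * C * nm T * (2 * d')) <=
      nm (A (Q k (T (Q k w)))).
    rewrite lerBlDr (le_trans xkd)// (le_trans (nm_triangleB _ (A (Q k (T (Q k w))))))//.
    by rewrite lerD2l -linearB (le_trans (nm_bop _ _))// ler_wpM2l.
  have h3 : nm (A (J a (w - Q k w))) <= nm A * (C' * nm a * (2 * d')).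
    rewrite (le_trans (nm_bop _ _))// ler_wpM2l// (le_trans (nm_bop _ _))//.
    by rewrite ler_pM ?nm_ge0.
  have h4 : nm (A (J a w)) <= nm (bop_mult A B (J a)) * (1 + C).
    rewrite -[A (J a w)]/(bop_mult A B (J a) (g (nk k)).1).
    by rewrite (le_trans (nm_bop _ _))// ler_wpM2l ?nm_ge0.
  have h5 : nm (a k : K^o) * nm (A (Q k (T (Q k w)))) <=
      nm (A (J a w)) + nm (A (J a (w - Q k w))).
    rewrite -nmZ -linearZ -JQ /=.
    have -> : A (J a (Q k w)) = A (J a w) - A (J a (w - Q k w)).
      by rewrite -!linearB subKr.
    exact: nmB.
  have dH : d' * H = d / 4 by rewrite /d' divfK ?gt_eqF.
  have ak := @nm_ge0 _ _ K^o (a k); have na := nm_ge0 a.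
  have b1 : nm A * (2 * d' + 2 * C * nm T * (2 * d')) <= d / 4.
    rewrite -dH /H; have : 0 <= d' * (2 * nm A * C' + 1).
      by rewrite mulr_ge0 ?ltW// ltr_wpDl// !mulr_ge0.
    by lra.
  have b2 : nm A * (C' * nm a * (2 * d')) <= d / 4 * nm a.
    rewrite -dH; have : 0 <= d' * (nm A * (2 + 4 * C * nm T) + 1) * nm a.
      rewrite mulr_ge0// mulr_ge0 ?(ltW d'0)// addr_ge0// mulr_ge0// addr_ge0//.
      by rewrite !mulr_ge0.
    by rewrite /H; lra.
  have : nm (a k : K^o) * (3 / 4 * d) <= nm (a k : K^o) * nm (A (Q k (T (Q k w)))).
    by rewrite ler_wpM2l//; lra.
  by lra.
have C1 : 0 < 1 + C by rewrite ltr_pwDl.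
apply: (@c0_singular_not_bounded_below _ _ _ _ _ J (d / 2 / (1 + C)) _ ABsing).
  by rewrite !divr_gt0.
(* The supremum over k gives 3d/4 |a| on the left; absorbing the error d/4 |a| leaves d/2. *)
move=> a; rewrite mulrAC ler_pdivrMr//.
have : nm a <= (nm (bop_mult A B (J a)) * (1 + C) + d / 4 * nm a) / (3 / 4 * d).
  by apply: nm_c0_le => k; rewrite ler_pdivlMr ?mulr_gt0 ?divr_gt0.
rewrite ler_pdivlMr ?mulr_gt0 ?divr_gt0//; lra.
Qed.

End C0Step.

(** * Positive functionals and pointwise convergence *)

Section HahnBanach.
Context {R : realType} {V : lmodType R} (D : set V).
Hypothesis D_sub : linear_subspace D.

Let D0 : D 0. Proof. by have [] := D_sub; rewrite inE. Qed.

Let DD f g : D f -> D g -> D (f + g).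
Proof.
move=> Df Dg; have [_ /(_ 1 f g)] := D_sub.
by rewrite scale1r !inE; exact.
Qed.

Let DZ t f : D f -> D (t *: f).
Proof.
move=> Df; have [_ /(_ t f 0)] := D_sub.
by rewrite addr0 !inE; exact.
Qed.

Let DN f : D f -> D (- f).
Proof. by rewrite -scaleN1r; exact: DZ. Qed.

(** One inequality of positive homogeneity suffices: scaling by the inverse of t gives the other. *)
Definition sublinear_on (p : V -> R) :=
  (forall f g, D f -> D g -> p (f + g) <= p f + p g) /\
  (forall t f, 0 < t -> D f -> p (t *: f) <= t * p f).

Section Sublinear.
Context (p : V -> R).
Hypothesis p_sub : sublinear_on p.

Let pZ t f : 0 < t -> D f -> p (t *: f) = t * p f.
Proof.
move=> t0 Df; apply/le_anti; rewrite p_sub.2//=.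
have := p_sub.2 t^-1 (t *: f); rewrite invr_gt0 scalerA mulVf ?gt_eqF// scale1r.
by move=> /(_ t0 (DZ _ Df)); rewrite ler_pdivlMl.
Qed.

Let p0 : p 0 = 0.
Proof. by have := pZ (ltr0n R 2) D0; rewrite scaler0; lra. Qed.

Lemma sublinear_lower f : D f -> - p (- f) <= p f.
Proof.
by move=> Df; have := p_sub.1 f (- f) Df (DN Df); rewrite subrr p0; lra.
Qed.

(** The usual lowering of p towards a functional additive in the direction h: it is sublinear and
    below p, so it equals p when p is minimal, and t = 1 then gives p f + p h <= p (f + h). *)
Definition slope_inf h f := inf [set p (f + t *: h) - t * p h | t in [set t | 0 <= t]].

Lemma slope_inf_lb h f t : D h -> D f -> 0 <= t ->
  - p (- f) <= p (f + t *: h) - t * p h.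
Proof.
move=> Dh Df t0; have := p_sub.1 (f + t *: h) (- f) (DD Df (DZ t Dh)) (DN Df).
rewrite addrAC subrr add0r; have [->|tn0] := eqVneq t 0.
  by rewrite scale0r p0 mul0r; lra.
by rewrite pZ// ?lt_def ?tn0//; lra.
Qed.

Lemma slope_inf_le h f t : D h -> D f -> 0 <= t ->
  slope_inf h f <= p (f + t *: h) - t * p h.
Proof.
move=> Dh Df t0; apply: ge_inf; last by exists t.
by exists (- p (- f)) => _ [u u0 <-]; exact: slope_inf_lb.
Qed.

Lemma slope_inf_ge h f c :
  (forall t, 0 <= t -> c <= p (f + t *: h) - t * p h) -> c <= slope_inf h f.
Proof.
move=> hc; apply: lb_le_inf.
  by exists (p (f + 0 *: h) - 0 * p h), 0 => /=.
by move=> _ [t t0 <-]; exact: hc.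
Qed.

Lemma slope_inf_sublinear h : D h -> sublinear_on (slope_inf h).
Proof.
move=> Dh; split=> [f g Df Dg|c f c0 Df].
  rewrite -lerBlDl; apply: slope_inf_ge => t t0.
  rewrite lerBlDl -lerBlDr; apply: slope_inf_ge => u u0; rewrite lerBlDr.
  have tu : 0 <= t + u by rewrite addr_ge0.
  rewrite (le_trans (slope_inf_le Dh (DD Df Dg) tu))//.
  have := p_sub.1 (g + t *: h) (f + u *: h) (DD Dg (DZ _ Dh)) (DD Df (DZ _ Dh)).
  by rewrite addrACA -scalerDl [g + f]addrC; lra.
rewrite -ler_pdivrMl//; apply: slope_inf_ge => t t0; rewrite ler_pdivrMl//.
have ct : 0 <= c * t by rewrite mulr_ge0// ltW.
rewrite (le_trans (slope_inf_le Dh (DZ _ Df) ct))//.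
by rewrite -scalerA -scalerDr pZ ?mulrBr ?mulrA//; exact/DD/DZ.
Qed.

End Sublinear.

(* Hahn-Banach: a minimal sublinear functional is additive. *)
Lemma sublinear_dominates (p : V -> R) : sublinear_on p ->
  exists l : V -> R, (forall f g, D f -> D g -> l (f + g) = l f + l g) /\
    (forall f, D f -> l f <= p f).
Proof.
move=> p_sub.
pose S := {q : V -> R | sublinear_on q /\ forall f, D f -> q f <= p f}.
(* The order is reversed, so that Zorn's lemma produces a minimal functional. *)
pose le (q r : S) := `[< forall f, D f -> sval r f <= sval q f >].
have [||A Atot|q qmin] := @ZL_preorder S (exist _ p (conj p_sub (fun f _ => lexx _))) le.
- by move=> q; apply/asboolP.
- move=> q r t /asboolP qr /asboolP rt; apply/asboolP => f Df.
  exact: le_trans (rt f Df) (qr f Df).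
- have [[q0 Aq0]|A0] := pselect (A !=set0); last first.
    exists (exist _ p (conj p_sub (fun f _ => lexx _))) => q Aq.
    by exfalso; apply: A0; exists q.
  pose r f := inf [set sval q f | q in A].
  have lb f : D f -> has_lbound [set sval q f | q in A].
    move=> Df; exists (- p (- f)) => _ [q Aq <-]; have [q_sub qp] := svalP q.
    by rewrite (le_trans _ (sublinear_lower q_sub Df))// lerN2 qp//; exact: DN.
  have rle q f : A q -> D f -> r f <= sval q f.
    by move=> Aq Df; apply: ge_inf; [exact: lb|exists q].
  have rge f c : (forall q, A q -> c <= sval q f) -> c <= r f.
    move=> h; apply: lb_le_inf; first by exists (sval q0 f), q0.
    by move=> _ [q Aq <-]; exact: h.
  (* For subadditivity of the infimum of a chain, the smaller of two members bounds both terms. *)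
  have r_sub : sublinear_on r.
    split=> [f g Df Dg|t f t0 Df].
      rewrite -lerBlDl; apply: (@rge) => q Aq; rewrite lerBlDl -lerBlDr.
      apply: (@rge) => q' Aq'; rewrite lerBlDr.
      have [/asboolP h|/asboolP h] := Atot q q' Aq Aq'.
        rewrite (le_trans (rle q' _ Aq' (DD Df Dg)))//.
        have [[q'D _] _] := svalP q'.
        by rewrite (le_trans (q'D f g Df Dg))// lerD// h.
      rewrite (le_trans (rle q _ Aq (DD Df Dg)))//.
      have [[qD _] _] := svalP q.
      by rewrite (le_trans (qD f g Df Dg))// lerD// h.
    rewrite -ler_pdivrMl//; apply: (@rge) => q Aq; rewrite ler_pdivrMl//.
    rewrite (le_trans (rle q _ Aq (DZ _ Df)))//.
    by have [[_ qZ] _] := svalP q; exact: qZ.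
  have rp f : D f -> r f <= p f.
    by move=> Df; rewrite (le_trans (rle q0 f Aq0 Df))//; have [_] := svalP q0; exact.
  by exists (exist _ r (conj r_sub rp)) => q Aq; apply/asboolP => f Df; exact: rle.
have [q_sub qp] := svalP q; exists (sval q); split=> // f h Df Dh.
apply/le_anti; rewrite q_sub.1//=.
have sl_sub := slope_inf_sublinear q_sub Dh.
have sl_le g : D g -> slope_inf (sval q) h g <= sval q g.
  move=> Dg; rewrite (le_trans (slope_inf_le q_sub Dh Dg (lexx 0)))//.
  by rewrite scale0r mul0r addr0 subr0.
have sl_p g : D g -> slope_inf (sval q) h g <= p g.
  by move=> Dg; rewrite (le_trans (sl_le g Dg))// qp.
have /asboolP/(_ f Df) /= := qmin (exist _ _ (conj sl_sub sl_p)) (introT (asboolP _) sl_le).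
move=> /le_trans/(_ (slope_inf_le q_sub Dh Df ler01)).
by rewrite scale1r mul1r; lra.
Qed.

End HahnBanach.

(** * Eberlein's lattice argument *)

Section Eberlein.
Context {R : realType} {T : Type}.

Definition bounded_function (f : T -> R^o) := exists M : R, forall x, `|f x| <= M.

Lemma bounded_function_subspace : linear_subspace bounded_function.
Proof.
split=> [|a f g]; first by rewrite inE; exists 0 => x; rewrite normr0.
rewrite !inE => -[M fM] [N gN]; exists (`|a| * M + N) => x.
by rewrite (le_trans (ler_normD _ _))// lerD// normrM ler_wpM2l.
Qed.

Lemma bounded_functionP (f : T -> R^o) a b : (forall x, a <= f x <= b) -> bounded_function f.
Proof.
move=> fab; exists (`|a| + `|b|) => x; have /andP[fa fb] := fab x.
rewrite ler_norml; have := ler_norm b; have := ler_norm (- a); rewrite normrN.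
have := normr_ge0 a; have := normr_ge0 b; lra.
Qed.

Context (l : (T -> R^o) -> R) (L : R).
Hypothesis L0 : 0 < L.
Hypothesis lD : forall f g, bounded_function f -> bounded_function g ->
  l (f + g) = l f + l g.
Hypothesis l_ge0 : forall f, bounded_function f -> (forall x, 0 <= f x) -> 0 <= l f.
Hypothesis l_le : forall f c, bounded_function f -> (forall x, f x <= c) ->
  l f <= L * c.

Lemma functional_mono f g : bounded_function f -> bounded_function g ->
  (forall x, f x <= g x) -> l f <= l g.
Proof.
move=> fb gb fg; have gfb : bounded_function (g - f).
  have := linear_subspaceB bounded_function_subspace gb fb; exact.
rewrite -[g](subrK f) lD// lerDr l_ge0// => x.
by rewrite -[(g - f) x]/(g x - f x) subr_ge0.
Qed.

(* With h_n a maximum of finitely many f_k, k >= n, almost realizing the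
   supremum M_n of [l] on such maxima, the inequality
   l (min a b) = l a + l b - l (max a b) keeps l (min_(j <= n) h_j) close to
   M_n. *)
Lemma eberlein (f : nat -> T -> R^o) M d : 0 < d ->
  (forall k x, 0 <= f k x <= M) -> (forall k, d <= l (f k)) ->
  exists m : nat -> nat, forall n, exists x, forall j, (j <= n)%N ->
    exists k, (j <= k <= m j)%N /\ d / (4 * L) <= f k x.
Proof.
move=> d0 fM fd.
pose mx n := fix mx j : T -> R^o := if j is j'.+1 then
  fun x => Num.max (mx j' x) (f (n + j'.+1)%N x) else f n.
have mxM n j x : 0 <= mx n j x <= M.
  elim: j => [|j /andP[h0 hM]] /=; first exact: fM.
  have /andP[f0 fM'] := fM (n + j.+1)%N x.
  by rewrite le_max h0 /= ge_max hM.
have mxb n j : bounded_function (mx n j) by exact: bounded_functionP (mxM n j).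
have mx_ge n j k x : (n <= k <= n + j)%N -> f k x <= mx n j x.
  elim: j => [|j IH] /=; first by rewrite addn0 => /anti_leq ->.
  rewrite le_max; have [->|kn] := eqVneq k (n + j.+1)%N.
    by rewrite lexx orbT.
  by move=> nkj; rewrite IH//; lia.
have mx_le n j x c : (forall k, (n <= k <= n + j)%N -> f k x <= c) -> mx n j x <= c.
  elim: j => [|j IH] fc /=; first by apply: fc; lia.
  by rewrite ge_max IH => [|k kn]; rewrite fc//; lia.
have mx_ex n j x c : c <= mx n j x -> exists k, (n <= k <= n + j)%N /\ c <= f k x.
  elim: j => [|j IH] /=; first by move=> cf; exists n; split=> //; lia.
  rewrite le_max => /orP[/IH[k [kn ck]]|cf]; first by exists k; split=> //; lia.
  by exists (n + j.+1)%N; split=> //; lia.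
pose Mn n := sup (range (fun j => l (mx n j))).
have Mn_ub n : has_ubound (range (fun j => l (mx n j))).
  exists (L * M) => _ [j _ <-]; apply: l_le => // x.
  by have /andP[] := mxM n j x.
have le_Mn n j : l (mx n j) <= Mn n.
  by apply: ub_le_sup; [exact: Mn_ub|exists j].
pose t n : R := 2^-1 ^+ n.
have t0 n : 0 < t n by rewrite exprn_gt0// invr_gt0.
have tS n : t n = 2 * t n.+1 by rewrite /t exprS mulrA mulfV ?mul1r.
have /choice[J JP] : forall n, exists j, Mn n - d / 2 * t n.+1 < l (mx n j).
  move=> n; have [||_ [j _ <-] h] := @sup_adherent _ (range (fun j => l (mx n j))) (d / 2 * t n.+1).
  - by rewrite mulr_gt0 ?divr_gt0.
  - by split; [exists (l (mx n 0%N)), 0%N|exact: Mn_ub].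
  - by exists j.
pose H := fix H n : T -> R^o := if n is n'.+1 then
  fun x => Num.min (H n' x) (mx n'.+1 (J n'.+1) x) else mx 0%N (J 0%N).
have H_le n j x : (j <= n)%N -> H n x <= mx j (J j) x.
  elim: n => [|n IH] /=; first by rewrite leqn0 => /eqP ->.
  rewrite leq_eqVlt ltnS ge_min => /orP[/eqP ->|/IH ->//].
  by rewrite lexx orbT.
have HM n x : 0 <= H n x <= M.
  elim: n => [|n /andP[h0 hM]] /=; first exact: mxM.
  have /andP[m0 _] := mxM n.+1 (J n.+1) x.
  by rewrite le_min h0 m0 /= ge_min hM.
have Hb n : bounded_function (H n) by exact: bounded_functionP (HM n).
have H_ge n : Mn n - d / 2 * (1 - t n.+1) <= l (H n).
  elim: n => [|n IH] /=.
    have := JP 0%N; have := tS 0%N; rewrite {1}/t expr0; nra.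
  set h := mx n.+1 (J n.+1).
  pose G x : R^o := Num.max (H n x) (h x).
  have GM x : 0 <= G x <= M.
    have /andP[h0 hM] := mxM n.+1 (J n.+1) x; have /andP[H0 HM'] := HM n x.
    by rewrite /G le_max H0 /= ge_max hM HM'.
  have Gb : bounded_function G by exact: bounded_functionP GM.
  have mb : bounded_function (fun x => Num.min (H n x) (h x)) by exact: (Hb n.+1).
  have E : l (fun x => Num.min (H n x) (h x)) + l G = l (H n) + l h.
    rewrite -(lD mb Gb) -(lD (Hb n) (mxb _ _)); congr (l _); apply/funext => x.
    by rewrite -[LHS]/(Num.min (H n x) (h x) + Num.max (H n x) (h x)) addr_min_max.
  (* Both H n and h lie below maxima of finitely many f_k with k >= n, hence so does G. *)
  have GMn : l G <= Mn n.
    rewrite (le_trans _ (le_Mn n (J n + J n.+1).+1))//.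
    apply: functional_mono => // x; rewrite /G ge_max; apply/andP; split.
      rewrite (le_trans (H_le n n x (leqnn n)))//.
      by apply: mx_le => k kn; apply: mx_ge; lia.
    by apply: mx_le => k kn; apply: mx_ge; lia.
  have := JP n.+1; rewrite -/h; have := tS n.+1; nra.
(* The window from j to m j does not depend on n, which is what lets the conclusion survive a limit
   in n. *)
exists (fun j => (j + J j)%N) => n.
(* Otherwise l (H n) <= d/4, while the accumulated errors stay below d/2 and M_n >= d. *)
have [x xH] : exists x, d / (4 * L) <= H n x.
  apply: contrapT => /forallNP nx; have : l (H n) <= L * (d / (4 * L)).
    by apply: l_le => // x; rewrite leNgt; apply/negP => /ltW; exact: nx.
  have -> : L * (d / (4 * L)) = d / 4 by field; rewrite gt_eqF.
  have := H_ge n; have := le_Mn n 0%N; have := fd n; have := t0 n.+1; rewrite /=; nra.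
exists x => j jn; apply: mx_ex; exact: le_trans xH (H_le n j x jn).
Qed.

End Eberlein.

(** * Dominated convergence for functionals on operators *)

Section UniformTail.
Context {R : realType} {s : scalars}.
Local Notation K := (scalar_field R s).

Lemma unimodular (z : K) : exists2 u : K, nm (u : K^o) <= 1 & toR (u * z) = nm (z : K^o).
Proof.
have [->|z0] := eqVneq z 0.
  by exists 0; rewrite ?(@nm0 _ _ K^o) ?mul0r// -(@ofR0 R s) ofRK.
exists (`|z| / z); last by rewrite divfK.
by rewrite /nm normrM normfV normr_id divff ?normr_eq0// -(@ofR1 R s) ofRK.
Qed.

Lemma toR_le_nm (z : K^o) : toR (z : K) <= nm z.
Proof. exact: toR_le_norm. Qed.

Context {X : completeNormedModType K} {e : nat -> X} {co : X -> nat -> K}.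
Context (P : nat -> bop X X) (f : nat -> dual X) (C : R).
Hypothesis PE : forall n x, P n x = psum e co xpredT n x.
Hypothesis fE : forall i x, f i x = co x i.
Hypothesis C0 : 0 <= C.
Hypothesis PC : forall n x, nm (P n x) <= C * nm x.
Hypothesis P_cvg : forall x, (fun n => P n x) @ \oo --> x.
Hypothesis Xrefl : reflexive_space X.

(* The partial sums are coordinatewise continuous, unlike the norm: these sets
   contain the unit balls of X and of its operators, and stay compact for
   coordinatewise convergence. *)
Definition fat_ball : set X := [set x | forall n, nm (P n x) <= C].

Definition fat_operator_ball : set (bop X X) :=
  [set T | forall n x, nm (P n (T x)) <= C * nm x].

Lemma nm_partial_le x c : (forall n, nm (P n x) <= c) -> nm x <= c.
Proof. by move=> h; apply: (cvg_nm_le (@P_cvg x)); exact: nearW. Qed.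

Lemma fat_operator_ballE T x : fat_operator_ball T -> nm (T x) <= C * nm x.
Proof. by move=> h; apply: nm_partial_le => n; exact: h. Qed.

Lemma unit_fat_ball x : nm x <= 1 -> fat_ball x.
Proof. by move=> x1 n; rewrite (le_trans (PC _ _))// -[leRHS]mulr1 ler_wpM2l. Qed.

Lemma cvg_partial (T : Type) (U : set_system T) {FF : Filter U} (g : T -> X) x n :
  (forall i, (fun t => f i (g t)) @ U --> f i x) ->
  (fun t => P n (g t)) @ U --> P n x.
Proof.
move=> gx; have -> : (fun t => P n (g t)) =
    (fun t => \sum_(0 <= i < n) (f i (g t) : K) *: e i).
  by apply/funext => t; rewrite PE; apply: eq_bigr => i _; rewrite fE.
have -> : P n x = \sum_(0 <= i < n) (f i x : K) *: e i.
  by rewrite PE; apply: eq_bigr => i _; rewrite fE.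
by apply: cvg_bigsum => i _; apply: cvg_nmZ.
Qed.

Section Dominated.
Context (phi : dual (bop X X)) (S : nat -> bop X X) (M : R).
Hypothesis S_bounded : forall k x, fat_ball x -> nm (S k x) <= M.
Hypothesis S_tail : forall k (d : R), 0 < d ->
  exists N, forall r x, (N <= r)%N -> nm (S k (x - P r x)) <= d * nm x.
Hypothesis S_cvg : forall x, (fun k => S k x) @ \oo --> (0 : X).

Let T := {x : X | fat_ball x}.
(** The infimum of this set is designed so that l <= p gives Re (phi S') <= l (x |-> |S' x|), by
    taking g = - |S' x| and c = 0, and l >= 0 by taking S' = 0. The added 1 keeps the constant
    positive when phi = 0. *)
Let dom (g : T -> R^o) : set R := [set r | exists (c : R) (S' : bop X X),
  (forall x : T, g x + nm (S' (sval x)) <= c) /\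
  r = (nm phi + 1) * c - toR (phi S' : K)].

Let bounded_nm (S' : bop X X) c : 0 <= c ->
  (forall x : T, nm (S' (sval x)) <= c) -> nm S' <= c.
Proof.
move=> c0 Sc; apply: nm_bop_le => // x.
have [->|x0] := eqVneq x 0; first by rewrite linear0 !nm0 mulr0.
have nx := nm_gt0 x0; rewrite -ler_pdivrMr// mulrC.
rewrite -[X in X * _]gtr0_norm ?invr_gt0// -nmZR -linearZ.
have h : fat_ball (ofR (nm x)^-1 *: x).
  by apply: unit_fat_ball; rewrite nmZR gtr0_norm ?invr_gt0// mulVf ?gt_eqF.
exact: (Sc (exist _ _ h)).
Qed.

Let fat0 : fat_ball 0. Proof. by apply: unit_fat_ball; rewrite nm0. Qed.

(** From g >= -m follows |S'| <= c + m, since the fat ball contains the unit ball; this keeps the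
    infimum finite. *)
Let dom_lb g m : 0 <= m -> (forall x, - m <= g x) ->
  lbound (dom g) (- ((nm phi + 1) * m)).
Proof.
move=> m0 gm r [c [S' [Sc ->]]].
have S'c (x : T) : nm (S' (sval x)) <= c + m by have := Sc x; have := gm x; lra.
have cm : 0 <= c + m by rewrite (le_trans _ (S'c (exist _ _ fat0)))// nm_ge0.
have := le_trans (toR_le_nm (phi S')) (nm_bop phi S').
have := bounded_nm cm S'c; have := nm_ge0 phi; have := nm_ge0 S'; nra.
Qed.

Let p g := inf (dom g).

Let p_le g c (S' : bop X X) : bounded_function g ->
  (forall x : T, g x + nm (S' (sval x)) <= c) ->
  p g <= (nm phi + 1) * c - toR (phi S' : K).
Proof.
move=> [m gm] Sc; apply: ge_inf; last by exists c, S'.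
exists (- ((nm phi + 1) * `|m|)); apply: dom_lb => // x.
have := le_trans (gm x) (ler_norm m); rewrite ler_norml => /andP[h _].
exact: h.
Qed.

Let p_ge g c : bounded_function g -> (forall r, dom g r -> c <= r) -> c <= p g.
Proof.
move=> [m gm] h; apply: lb_le_inf => //.
exists ((nm phi + 1) * m - toR (phi 0 : K)), m, 0; split=> // x.
by rewrite nm0 addr0; exact: le_trans (ler_norm _) (gm x).
Qed.

Let p_sub : sublinear_on (@bounded_function R T) p.
Proof.
have bf := @bounded_function_subspace R T.
split=> [g h gb hb|t g t0 gb].
  have ghb : bounded_function (g + h).
    have [_ /(_ 1 g h)] := bf.
    by rewrite scale1r !inE; exact.
  rewrite -lerBlDl; apply: (p_ge hb) => r [c [S' [Sc ->]]].
  rewrite lerBlDl -lerBlDr; apply: (p_ge gb) => r' [c' [S'' [Sc' ->]]].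
  rewrite lerBlDr.
  have := @p_le (g + h) (c' + c) (S'' + S') ghb.
  rewrite linearD toRD => /(_ _)/le_trans -> //; last by lra.
  move=> x; rewrite -[(g + h) x]/(g x + h x) bopD.
  by have := Sc x; have := Sc' x; have := nmD (S'' (sval x)) (S' (sval x)); lra.
have tgb : bounded_function (t *: g).
  have [_ /(_ t g 0)] := bf; rewrite addr0 !inE; apply=> //.
  by exists 0 => x; rewrite normr0.
rewrite -ler_pdivrMl//; apply: (p_ge gb) => r [c [S' [Sc ->]]].
rewrite ler_pdivrMl//.
have := @p_le (t *: g) (t * c) (ofR t *: S') tgb.
rewrite linearZ toRZ => /(_ _)/le_trans -> //; last by lra.
move=> x; rewrite bopZ nmZR gtr0_norm// -[(t *: g) x]/(t * g x) -mulrDr.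
by rewrite ler_wpM2l// ltW.
Qed.

(* Hahn-Banach, applied to [p], majorizes [phi] by a positive functional [l] of
   bounded functions on the fat ball: [|phi (S k)| <= l (x |-> |S k x|)]. These
   functions tend to 0 pointwise and are weakly continuous by [S_tail], so that
   a cluster point of the points given by Eberlein's lemma is contradictory. *)
Lemma dominated_convergence_operators (d : R) : 0 < d ->
  ~ forall k, d <= nm (phi (S k)).
Proof.
move=> d0 Sd.
have bf := @bounded_function_subspace R T.
have [l [lD lp]] := sublinear_dominates bf p_sub.
(* Phases u_k turn |phi (S k)| into the real part that p controls. *)
have /choice[u uP] : forall k, exists u : K, nm (u : K^o) <= 1 /\
    toR (u * phi (S k) : K) = nm (phi (S k)).
  by move=> k; have [u u1 uE] := unimodular (phi (S k)); exists u.
pose g k (x : T) : R^o := nm (u k *: S k (sval x)).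
have g0M k x : 0 <= g k x <= M.
  rewrite /g nm_ge0 /= nmZ -[leRHS]mul1r ler_pM ?nm_ge0//; first by have [] := uP k.
  by apply: S_bounded; exact: (svalP x).
have gb k : bounded_function (g k) by exact: bounded_functionP (g0M k).
have b0 : bounded_function (0 : T -> R^o) by exists 0 => x; rewrite normr0.
have l0 : l 0 = 0 by have := lD 0 0 b0 b0; rewrite addr0; lra.
have lN h : bounded_function h -> l (- h) = - l h.
  move=> hb; have hNb : bounded_function (- h).
    by have := linear_subspaceB bf b0 hb; rewrite sub0r.
  by have := lD h (- h) hb hNb; rewrite subrr l0; lra.
have bN h : bounded_function h -> bounded_function (- h : T -> R^o).
  by move=> hb; have := linear_subspaceB bf b0 hb; rewrite sub0r.
have phi0 : toR (phi 0 : K) = 0 by rewrite linear0 -[0 in LHS](@ofR0 R s) ofRK.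
have L0 : 0 < nm phi + 1 by rewrite ltr_wpDl ?nm_ge0.
have l_ge0 h : bounded_function h -> (forall x, 0 <= h x) -> 0 <= l h.
  move=> hb h0; rewrite -oppr_le0 -lN// (le_trans (lp _ (bN _ hb)))//.
  rewrite (le_trans (p_le (c := 0) (S' := 0) (bN _ hb) _))// ?mulr0 ?phi0 ?subr0//.
  by move=> x; rewrite nm0 addr0 oppr_le0.
have l_le h c : bounded_function h -> (forall x, h x <= c) -> l h <= (nm phi + 1) * c.
  move=> hb hc; rewrite (le_trans (lp _ hb))//.
  rewrite (le_trans (p_le (c := c) (S' := 0) hb _))// ?phi0 ?subr0//.
  by move=> x; rewrite nm0 addr0.
have ld k : d <= l (g k).
  rewrite (le_trans (Sd k))// -[leLHS](uP k).2 -lerN2 -lN//.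
  rewrite (le_trans (lp _ (bN _ (gb k))))//.
  rewrite (le_trans (p_le (c := 0) (S' := u k *: S k) (bN _ (gb k)) _))//.
    by move=> x; rewrite bopZ -[(- g k) x]/(- g k x) addNr.
  by rewrite mulr0 sub0r linearZ.
have [m mP] := eberlein L0 lD l_ge0 l_le d0 g0M ld.
have /choice[x xP] := mP.
set eta := d / (4 * (nm phi + 1)) in xP.
have eta0 : 0 < eta by rewrite divr_gt0// mulr_gt0.
have [U [UU oU]] := @ultraFilterLemma nat \oo _.
have xC n : nm (sval (x n)) <= C by apply: nm_partial_le => i; exact: (svalP (x n)).
have [|y yP] := @reflexive_ultra R s X _ U (fun n => sval (x n)) C UU Xrefl.
  exact: nearW.
have Py n : (fun i => P n (sval (x i))) @ U --> P n y by apply: cvg_partial.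
have yC : nm y <= C.
  apply: nm_partial_le => n; apply: (cvg_nm_le (Py n)); apply: nearW => i.
  exact: (svalP (x i)).
(* Up to a small multiple of the norm, S k factors through P_N, and P_N of the points converges in
   norm because it involves finitely many coordinates. *)
have Sy k : (fun n => S k (sval (x n))) @ U --> S k y.
  apply/cvg_nmP => c c0; pose c' := c / 2 / (2 * C + 1).
  have c'0 : 0 < c' by rewrite !divr_gt0// ltr_wpDl// mulr_ge0.
  have [N NP] := S_tail k c'0.
  have c2 : 0 < c / 2 / (nm (S k) + 1) by rewrite !divr_gt0// ltr_wpDl ?nm_ge0.
  have /cvg_nmP/(_ _ c2) := Py N; apply: filterS => n yn.
  rewrite -linearB -{1}[y - sval (x n)](subrK (P N (y - sval (x n)))) linearD.
  rewrite (le_lt_trans (nmD _ _))// [c in ltRHS]splitr ler_ltD//.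
    rewrite (le_trans (NP _ _ (leqnn N)))//.
    rewrite (@le_trans _ _ (c' * (2 * C + 1)))//; last first.
      by rewrite /c' divfK// gt_eqF// ltr_wpDl// mulr_ge0.
    rewrite ler_pM2l// (le_trans (nmB _ _))//.
    by have := xC n; have := yC; lra.
  move: yn; rewrite linearB ltr_pdivlMr ?ltr_wpDl ?nm_ge0//.
  apply: le_lt_trans; rewrite (le_trans (nm_bop _ _))// mulrC.
  by rewrite ler_wpM2l ?nm_ge0// lerDl.
have [j _ jP] : \forall k \near \oo, nm (S k y) < eta / 2.
  have /cvg_nmP/(_ (eta / 2)) := S_cvg y.
  rewrite divr_gt0// => /(_ isT); apply: filterS => k.
  by rewrite sub0r nmN.
(* Only the finitely many k up to m j matter, so one n serves them all. *)
have fin q : U [set n | forall k, (k <= q)%N -> nm (S k y - S k (sval (x n))) < eta / 2].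
  elim: q => [|q IH].
    have /cvg_nmP/(_ (eta / 2)) := Sy 0%N; rewrite divr_gt0// => /(_ isT).
    by apply: filterS => n h k; rewrite leqn0 => /eqP ->.
  have /cvg_nmP/(_ (eta / 2)) := Sy q.+1; rewrite divr_gt0// => /(_ isT) h.
  apply: filterS2 h IH => n h1 h2 k; rewrite leq_eqVlt ltnS => /orP[/eqP ->//|].
  exact: h2.
have Uj : U [set n | (j <= n)%N] by apply: oU; exists j.
have [n [nfin jn]] := filter_ex (filterI (fin (m j)) Uj).
have [k [/andP[jk km] gk]] := xP n j jn.
move: gk; apply/negP; rewrite -ltNge.
have h1 := nfin k km; have h2 : nm (S k y) < eta / 2 := jP k jk.
rewrite /g nmZ (@le_lt_trans _ _ (nm (S k (sval (x n)))))//.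
  by rewrite ler_piMl ?nm_ge0//; have [] := uP k.
rewrite (le_lt_trans (nm_triangleB _ (S k y)))// nmC.
by rewrite [eta]splitr ltrD.
Qed.

End Dominated.
End UniformTail.

(** * Weak compactness *)

Section WeakCompactness.
Context {R : realType} {s : scalars}.
Local Notation K := (scalar_field R s).

Lemma weak_cvg (V : normedModType K) (T : Type) (F : set_system T)
    {FF : Filter F} (g : T -> V) (y : V) :
  (forall phi : dual V, (fun t => phi (g t)) @ F --> phi y) ->
  (g : T -> weak_space V) @ F --> (y : weak_space V).
Proof.
move=> gy A [_ [[D oD <-] Dy] DA].
have ev : (fun t => (fun phi : dual V => phi (g t)) : {ptws dual V -> K}) @ F -->
    ((fun phi : dual V => phi y) : {ptws dual V -> K}).
  apply/pointwise_cvgP => phi; exact: gy.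
have /ev : nbhs ((fun phi : dual V => phi y) : {ptws dual V -> K}) D.
  exact: open_nbhs_nbhs.
move=> FD; change (F (fun t => D (fun phi : dual V => phi (g t)))) in FD.
by apply: filterS FD => t; exact: DA.
Qed.

Lemma weak_hausdorff (V : normedModType K) :
  (forall x y : V, (forall phi : dual V, phi x = phi y) -> x = y) ->
  hausdorff_space (weak_space V).
Proof.
move=> sep x y xy; apply: sep => phi.
have phic z (d : R) : 0 < d -> nbhs (z : weak_space V) [set t | nm (phi z - phi t) < d].
  move=> d0; pose ev (t : weak_space V) : {ptws dual V -> K} := fun phi => phi t.
  have evz : ev @ nbhs (z : weak_space V) --> ev z by exact: initial_continuous.
  have /pointwise_cvgP/(_ phi) := evz.
  by move=> /(@cvg_nmP _ _ K^o)/(_ _ d0).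
apply/eqP; rewrite -subr_eq0; apply: contraT => /(@nm_gt0 _ _ K^o) d0.
have d2 : 0 < nm (phi x - phi y) / 2 by rewrite divr_gt0.
have [t [xt yt]] := xy _ _ (phic x _ d2) (phic y _ d2).
have := nm_dist (phi x) (phi t) (phi y); rewrite leNgt => /negP[].
by rewrite [ltRHS]splitr ltrD// nmC.
Qed.

Context {X : completeNormedModType K} {e : nat -> X} {co : X -> nat -> K}.
Context (P : nat -> bop X X) (f : nat -> dual X) (C : R).
Hypothesis PE : forall n x, P n x = psum e co xpredT n x.
Hypothesis fE : forall i x, f i x = co x i.
Hypothesis C0 : 0 <= C.
Hypothesis PC : forall n x, nm (P n x) <= C * nm x.
Hypothesis P_cvg : forall x, (fun n => P n x) @ \oo --> x.
Hypothesis Xrefl : reflexive_space X.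
Local Notation fat := (fat_operator_ball P C).

Context (A B : bop X X).
Hypothesis AB_tail : forall (T : bop X X) (d : R), 0 < d ->
  exists N, forall r x, (N <= r)%N -> nm (A (T (B (x - P r x)))) <= d * nm x.

Lemma coordinates_separate (x y : X) : (forall i, f i x = f i y) -> x = y.
Proof.
move=> xy; apply: (cvg_nm_unique (@P_cvg x)).
have -> : (fun n => P n x) = (fun n => P n y); last exact: P_cvg.
by apply/funext => n; rewrite !PE; apply: eq_bigr => i _; rewrite -!fE xy.
Qed.

Lemma bop_mult_uniform_tail (phi : dual (bop X X)) (d : R) : 0 < d ->
  exists N, forall n T, (N <= n)%N -> fat T ->
    nm (phi (bop_mult A B T) - phi (bop_comp A (bop_comp T (bop_comp (P n) B)))) <= d.
Proof.
move=> d0; apply: contrapT => /forallNP nN.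
have /choice[p pP] : forall N, exists p : nat * bop X X, [/\ (N <= p.1)%N, fat p.2 &
    d <= nm (phi (bop_mult A B p.2) -
      phi (bop_comp A (bop_comp p.2 (bop_comp (P p.1) B))))].
  move=> N; have /existsNP[n /existsNP[T /not_implyP[Nn /not_implyP[Tf /negP]]]] := nN N.
  by rewrite -ltNge => /ltW h; exists (n, T).
pose S k : bop X X := bop_mult A B (p k).2 -
  bop_comp A (bop_comp (p k).2 (bop_comp (P (p k).1) B)).
have SE k x : S k x = A ((p k).2 (B x - P (p k).1 (B x))).
  by rewrite -[LHS]/(A ((p k).2 (B x)) - A ((p k).2 (P (p k).1 (B x)))) -!linearB.
have pT k x : nm ((p k).2 x) <= C * nm x.
  by have [_ h _] := pP k; exact: (fat_operator_ballE P_cvg).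
have Sle k x : nm (S k x) <= nm A * C * nm (B x - P (p k).1 (B x)).
  rewrite SE (le_trans (nm_bop _ _))// -mulrA ler_wpM2l ?nm_ge0//.
apply: (@dominated_convergence_operators _ _ X e co P f C PE fE C0 PC P_cvg Xrefl
  phi S (nm A * C * ((1 + C) * (nm B * C))) _ _ _ d d0).
- move=> k x xf; rewrite (le_trans (Sle k x))// ler_wpM2l ?mulr_ge0 ?nm_ge0//.
  rewrite (@le_trans _ _ ((1 + C) * nm (B x)))//.
    by rewrite (le_trans (nmB _ _))// mulrDl mul1r lerD2l.
  rewrite ler_wpM2l ?addr_ge0// (le_trans (nm_bop _ _))// ler_wpM2l ?nm_ge0//.
  exact: (nm_partial_le P_cvg).
- move=> k c c0.
  (* The factor 1 - P to the left of B is absorbed into the middle operator. *)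
  have [N NP] := AB_tail ((p k).2 - bop_comp (p k).2 (P (p k).1)) c0.
  exists N => r x Nr; rewrite (le_trans _ (NP r x Nr))// SE linearB.
  exact: lexx.
- move=> x; apply/cvg_nmP => c c0.
  have AC : 0 < nm A * C + 1 by rewrite ltr_wpDl// mulr_ge0 ?nm_ge0.
  have /cvg_nmP/(_ (c / (nm A * C + 1))) := @P_cvg (B x).
  rewrite divr_gt0// => /(_ isT)[N _ NP]; exists N => // k /= Nk.
  rewrite sub0r nmN (le_lt_trans (Sle k x))//.
  have [Nk' _ _] := pP k.
  have := NP _ (leq_trans Nk Nk'); rewrite /= ltr_pdivlMr//.
  apply: le_lt_trans; rewrite mulrC ler_wpM2l ?nm_ge0//.
  by rewrite lerDl.
- by move=> k; have [_ _] := pP k; rewrite -linearB.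
Qed.

(** Reflexivity gives a weak limit of [g t x] for each x. Bounds on partial sums, which see finitely
    many coordinates, pass to the limit, so the limit stays in the fat ball. *)
Lemma fat_operator_limit (T : Type) (U : set_system T) (g : T -> bop X X) :
  UltraFilter U -> (forall t, fat (g t)) ->
  exists2 T0 : bop X X, fat T0 &
    forall x (psi : dual X), (fun t => psi (g t x)) @ U --> psi (T0 x).
Proof.
move=> UU gf.
have /choice[h hP] : forall x, exists y : X, forall psi : dual X,
    (fun t => psi (g t x)) @ U --> psi y.
  move=> x; apply: (@reflexive_ultra R s X _ U (fun t => g t x) (C * nm x) UU Xrefl).
  by apply: nearW => t; exact: (fat_operator_ballE P_cvg).
have lin : linear h.
  move=> k x y; apply: coordinates_separate => i.
  apply: (@cvg_nm_unique _ _ K^o _ U _ (fun t => f i (g t (k *: x + y)))); first exact: hP.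
  have -> : (fun t => f i (g t (k *: x + y))) =
      (fun t => k *: f i (g t x) + f i (g t y)).
    by apply/funext => t; rewrite !linearP.
  rewrite linearP; apply: (@cvgD _ K^o); last exact: (hP y (f i)).
  by apply: (@cvgZl_tmp _ K^o); exact: (hP x (f i)).
have hfat n x : nm (P n (h x)) <= C * nm x.
  have := @cvg_partial _ _ _ _ _ P f PE fE _ U _ (fun t => g t x) (h x) n.
  move=> /(_ _ (fun i => hP x (f i))) hn; apply: (cvg_nm_le hn).
  by apply: nearW => t; exact: gf.
have [|T0 T0E _] := bopP lin C0.
  by move=> x; apply: (nm_partial_le P_cvg).
by exists T0 => [n x|x psi]; rewrite -T0E.
Qed.

(* T |-> phi (A T P_n B) only involves finitely many of the functionals
   T |-> psi (T (e i)). *)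
Lemma finite_part_cvg (T : Type) (U : set_system T) {FU : Filter U}
    (g : T -> bop X X) (T0 : bop X X) n (phi : dual (bop X X)) :
  (forall x (psi : dual X), (fun t => psi (g t x)) @ U --> psi (T0 x)) ->
  (fun t => phi (bop_comp A (bop_comp (g t) (bop_comp (P n) B)))) @ U -->
  phi (bop_comp A (bop_comp T0 (bop_comp (P n) B))).
Proof.
move=> gT.
(* A T' P_n B is the sum over i < n of the rank-one operators S (i, T' (e i)). *)
have rank1 (p : nat * X) : exists S : bop X X, forall x, S x = (f p.1 (B x) : K) *: A p.2.
  case: p => i z /=.
  have lin : linear (fun x => (f i (B x) : K) *: A z).
    by move=> k x y; rewrite !linearP scalerDl scalerA.
  have [||S SE _] := bopP lin (M := nm (f i) * nm B * nm (A z)).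
  - by rewrite !mulr_ge0 ?nm_ge0.
  - move=> x; rewrite nmZ mulrAC ler_wpM2r ?nm_ge0//.
    rewrite (le_trans (nm_bop _ _))// -mulrA ler_wpM2l ?nm_ge0//.
    exact: nm_bop.
  by exists S => x; rewrite -SE.
have [S SE] := choice rank1.
have functional i : exists psi : dual X, forall z, psi z = phi (S (i, z)).
  have lin : linear (fun z => phi (S (i, z)) : K^o).
    move=> k z w; rewrite -linearP; congr (phi _); apply/val_inj/funext => x.
    rewrite -[LHS]/(S (i, k *: z + w) x) -[RHS]/(k *: S (i, z) x + S (i, w) x).
    by rewrite !SE /= linearP scalerDr !scalerA mulrC.
  have [||psi psiE _] := bopP lin (M := nm phi * (nm (f i) * nm B * nm A)).
  - by rewrite !mulr_ge0 ?nm_ge0.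
  - move=> z; rewrite (le_trans (nm_bop _ _))// -[leRHS]mulrA ler_wpM2l ?nm_ge0//.
    apply: nm_bop_le => [|x]; first by rewrite !mulr_ge0 ?nm_ge0.
    rewrite SE nmZ /=.
    have h1 : nm (f i (B x)) <= nm (f i) * (nm B * nm x).
      by rewrite (le_trans (nm_bop _ _))// ler_wpM2l ?nm_ge0// nm_bop.
    rewrite (le_trans (ler_pM (nm_ge0 _) (nm_ge0 _) h1 (nm_bop A z)))//.
    by rewrite le_eqVlt; apply/orP; left; apply/eqP; ring.
  by exists psi => z; rewrite -psiE.
have [psi psiE] := choice functional.
have E (T' : bop X X) : phi (bop_comp A (bop_comp T' (bop_comp (P n) B))) =
    \sum_(0 <= i < n) psi i (T' (e i)).
  under eq_bigr do rewrite psiE.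
  rewrite -linear_sum; congr (phi _); apply/val_inj/funext => x.
  rewrite -[LHS]/(A (T' (P n (B x)))) -[RHS]/((\sum_(0 <= i < n) S (i, T' (e i))) x).
  rewrite bop_sumE PE /psum !linear_sum; apply: eq_bigr => i _.
  by rewrite SE /= fE !linearZ.
rewrite E; under eq_fun do rewrite E.
apply: (@cvg_bigsum _ _ K^o) => i _; exact: gT.
Qed.

(** The image of the fat ball, which contains that of the unit ball, is weakly compact, hence weakly
    closed because functionals T |-> f_i (T x) separate operators. *)
Lemma bop_mult_weakly_compact : weakly_compact (bop_mult A B).
Proof.
have comp : compact (bop_mult A B @` fat : set (weak_space (bop X X))).
  rewrite compact_ultra => F FU FA.
  have fat0 : fat 0 by move=> n x; rewrite [(0 : bop X X) x]/(0 : X) linear0 nm0 mulr_ge0 ?nm_ge0.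
  (* Preimages are chosen so that the ultrafilter lifts to operators; the default 0 off the image
     does not matter, as F contains the image. *)
  have /choice[g gP] : forall y : weak_space (bop X X), exists T : bop X X,
      fat T /\ ((bop_mult A B @` fat) y -> bop_mult A B T = y).
    move=> y; have [[T Tf Ty]|ny] := pselect ((bop_mult A B @` fat) y).
      by exists T.
    by exists 0.
  have [T0 T0f T0P] := fat_operator_limit FU (fun y => (gP y).1).
  exists (bop_mult A B T0); split; first by exists T0.
  apply: (@weak_cvg _ _ F _ id) => phi.
  apply/cvg_nmP => d d0; have d3 : 0 < d / 3 by rewrite divr_gt0.
  have [N NP] := bop_mult_uniform_tail phi d3.
  have FF : Filter F by exact: filter_filter.
  have /(_ FF)/cvg_nmP/(_ _ d3) h := finite_part_cvg (n := N) (phi := phi) T0P.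
  apply: filterS2 FA h => y Ay hy.
  have -> : phi y = phi (bop_mult A B (g y)) by rewrite ((gP y).2 Ay).
  (* Both T0 and [g y] are within d/3 of their truncations under phi, and the truncations are within
     d/3 of each other. *)
  have h1 := NP N T0 (leqnn N) T0f; have h2 := NP N (g y) (leqnn N) (gP y).1.
  rewrite (le_lt_trans (nm_dist _ (phi (bop_comp A (bop_comp T0 (bop_comp (P N) B)))) _))//.
  have := nm_dist (phi (bop_comp A (bop_comp T0 (bop_comp (P N) B))))
    (phi (bop_comp A (bop_comp (g y) (bop_comp (P N) B)))) (phi (bop_mult A B (g y))).
  rewrite [X in _ <= _ + X]nmC; lra.
exists (bop_mult A B @` fat); last first.
  split=> //; apply: compact_closed => //; apply: weak_hausdorff => S S' SS'.
  apply/val_inj/funext => x; apply: coordinates_separate => i.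
  have lin : linear (fun T : bop X X => f i (T x) : K^o).
    by move=> k T T'; rewrite -[(k *: T + T') x]/(k *: T x + T' x) linearP.
  have [||ev evE _] := bopP lin (M := nm (f i) * nm x).
  - by rewrite mulr_ge0 ?nm_ge0.
  - move=> T; rewrite (le_trans (nm_bop _ _))// -mulrA ler_wpM2l ?nm_ge0// mulrC.
    exact: nm_bop.
  by have := SS' ev; rewrite -evE.
move=> _ [T T1 <-]; exists T => // n x.
rewrite (le_trans (PC _ _))// ler_wpM2l// (le_trans (nm_bop _ _))//.
rewrite -[leRHS]mul1r ler_wpM2r ?nm_ge0//.
by rewrite -(@ofR_le R s) ofR1 -nmE.
Qed.

End WeakCompactness.

Theorem corollary4p2 (R : realType) (s : scalars)
    (X : completeNormedModType (scalar_field R s)) (A B : bop X X) :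
  (strictly_singular (bop_mult A B) -> c0_singular (bop_mult A B)) /\
  (reflexive_space X ->
   (exists e : nat -> X, unconditional_basis e) ->
   c0_singular (bop_mult A B) -> weakly_compact (bop_mult A B)).
Proof.
split; first exact: strictly_singular_c0_singular.
move=> Xrefl [e eb] ABsing.
have [co coP] := schauder_coordinates eb.1.
have [C C0 psumC] := unconditional_psum_bound coP eb.
have [P PE] := partial_sum_operators coP C0 psumC.
have [f fE] := coordinate_functionals coP C0 psumC.
have PC n x : nm (P n x) <= C * nm x by rewrite PE.
have P_cvg x : (fun n => P n x) @ \oo --> x.
  by under eq_fun do rewrite PE; exact: (@psum_cvg _ _ _ _ _ coP x).
have PP n m x : P n (P m x) = P (minn n m) x by rewrite !PE psum_psum.
have P_blocks (nk : nat -> nat) (G : pred nat) m x :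
    {homo nk : i j / (i <= j)%N} ->
    nm (\sum_(0 <= k < m | G k) (P (nk k.+1) x - P (nk k) x)) <= C * nm x.
  move=> nk_homo; under eq_bigr do rewrite !PE.
  by have [F ->] := psum_blocks (e := e) (co := co) G m nk_homo; exact: psumC.
have shrinking (psi : dual X) (d : R) : (0 < d)%R ->
    exists N, forall n x, (N <= n)%N -> nm (psi (x - P n x)) <= d * nm x.
  exact: (reflexive_shrinking coP PE fE PC psi Xrefl).
have P_tail := finite_rank_tail PE fE shrinking.
apply: (bop_mult_weakly_compact PE fE C0 PC P_cvg Xrefl) => T d d0.
exact: (c0_singular_tail C0 PC P_cvg PP P_blocks P_tail T ABsing d0).
Qed.
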